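(* Let $X$ be a Polish space. Let $\Gamma$ be a one-ended group of polynomial growth with finite generating set $S$, and let $G=G(S,a)$ be the Schreier graph of a free Borel action $a$ of $\Gamma$ on $X$. Then $G$ admits a connected toast (on all of $X$).
   Context: The Schreier graph $G(S,a)$ has vertex set $X$, with $x\ne y$ adjacent iff $y=s\cdot x$ or $x=s\cdot y$ for some $s\in S$. A connected graph is one-ended if for every finite set $F$ of vertices the induced subgraph on the complement of $F$ has exactly one infinite connected component; a finitely generated group is one-ended if its Cayley graph is. Toasts (for a Borel graph $G$ on $X$). $X^{<\omega}$ is the (standard Borel) space of finite subsets of $X$. For $K\subseteq X$, $E(K)$ is the set of edges of the subgraph induced on $K$, and $B_1(K)$ is the set of vertices at graph distance at most $1$ from $K$. A Borel collection $\mathcal{T}\subset X^{<\omega}$ is a toast for $G$ if (T1) $\bigcup_{K\in\mathcal{T}}E(K)=E(G)$, and (T2) for every pair of distinct $K,L\in\mathcal{T}$, either $B_1(K)\cap L=\emptyset$, or $B_1(K)\subseteq L$, or $B_1(L)\subseteq K$. It is connected if (T3) for every $K\in\mathcal{T}$ the induced subgraph on $K\setminus\bigcup_{K\supsetneq L\in\mathcal{T}}L$ is connected. *)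

(* Defs.v *)
From Stdlib Require Export Relation_Operators.
From mathcomp Require Export all_boot all_order all_algebra finmap.
From mathcomp Require Export all_classical reals topology measurable_structure.

Set Implicit Arguments.
Unset Strict Implicit.
Unset Printing Implicit Defensive.

Import Order.TTheory GRing.Theory Num.Theory.

Local Open Scope classical_set_scope.

(* A graph on V is an adjacency relation G : V -> V -> Prop; all the graphs
   considered below are symmetric and irreflexive. *)

Section Graphs.
Variables (V : Type) (G : V -> V -> Prop).
Implicit Types (A K C : set V).

(* Every edge is recorded with both of its orientations. *)
Definition edges A : set (V * V) :=
  [set e | [/\ G e.1 e.2, A e.1 & A e.2]].

(* Vertices at graph distance at most n from K. *)
Fixpoint gball (n : nat) K : set V :=
  if n is m.+1 then
    gball m K `|` [set y | exists2 x, gball m K x & G x y]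
  else K.

Definition reachable_in A (x y : V) : Prop :=
  clos_refl_trans V (fun u v => [/\ A u, A v & G u v]) x y.

Definition connected_in A : Prop :=
  forall x y, A x -> A y -> reachable_in A x y.

Definition component_in A C : Prop :=
  exists2 x, A x & C = [set y | reachable_in A x y].

Definition one_ended : Prop :=
  connected_in setT /\
  forall F : set V, finite_set F ->
    exists! C : set V, component_in (~` F) C /\ infinite_set C.

End Graphs.

Section Groups.
Variable Gamma : groupType.
Implicit Type S : set Gamma.
Local Open Scope group_scope.

Definition generates S : Prop :=
  forall H : set Gamma,
    H 1 -> (forall g h, H g -> H h -> H (g * h)) ->
    (forall g, H g -> H g^-1) -> S `<=` H -> H = setT.

Definition is_action (X : Type) (a : Gamma -> X -> X) : Prop :=
  (forall x, a 1 x = x) /\ (forall g h x, a (g * h) x = a g (a h x)).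

Definition free_action (X : Type) (a : Gamma -> X -> X) : Prop :=
  forall g x, a g x = x -> g = 1.

Definition schreier_graph (X : Type) S (a : Gamma -> X -> X) (x y : X) : Prop :=
  x <> y /\ exists2 s, S s & y = a s x \/ x = a s y.

Definition cayley_graph S : Gamma -> Gamma -> Prop :=
  schreier_graph S (fun g x => g * x).

Definition polynomial_growth S : Prop :=
  exists C d : nat, forall n : nat, (0 < n)%N ->
    (gball (cayley_graph S) n [set 1] #<= `I_(C * n ^ d))%card.

End Groups.

Section Polish.
Local Open Scope ring_scope.

Record complete_metric_for (R : realType) (X : topologicalType)
    (d : X -> X -> R) : Prop := CompleteMetricFor {
  cm_refl : forall x, d x x = 0;
  cm_eq : forall x y, d x y = 0 -> x = y;
  cm_sym : forall x y, d x y = d y x;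
  cm_triangle : forall x y z, d x z <= d x y + d y z;
  cm_nbhs : forall x (A : set X),
    nbhs x A <-> exists2 e : R, 0 < e & [set y | d x y < e] `<=` A;
  cm_complete : forall u : nat -> X,
    (forall e : R, 0 < e ->
       exists N, forall m n, (N <= m)%N -> (N <= n)%N -> d (u m) (u n) < e) ->
    exists l : X, u n @[n --> \oo] --> l
}.

Definition polish (R : realType) (X : topologicalType) : Prop :=
  (exists2 D : set X, countable D & dense D) /\
  (exists d : X -> X -> R, complete_metric_for d).

End Polish.

Section Borel.
Variable X : topologicalType.

Definition borel : set (set X) := <<s open >>.

(* The standard Borel structure on the finite subsets of X: the trace of the
   Effros Borel structure, i.e. the Borel sets of the Vietoris topology when X
   is Polish. *)
Definition fset_borel : set (set {fset X}) :=
  <<s [set [set K : {fset X} | [set` K] `&` U !=set0] | U in open] >>.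

(* Γ is countable and discrete, so an action Γ × X -> X is Borel iff each of
   its elements acts by a Borel map. *)
Definition borel_action (Gamma : groupType) (a : Gamma -> X -> X) : Prop :=
  is_action a /\ forall g B, borel B -> borel (a g @^-1` B).

Definition toast (G : X -> X -> Prop) (T : set {fset X}) : Prop :=
  [/\ fset_borel T,
      \bigcup_(K in T) edges G [set` K] = edges G setT
    & forall K L, T K -> T L -> K <> L ->
        [\/ gball G 1 [set` K] `&` [set` L] = set0,
            gball G 1 [set` K] `<=` [set` L]
          | gball G 1 [set` L] `<=` [set` K]]].

Definition connected_toast (G : X -> X -> Prop) (T : set {fset X}) : Prop :=
  toast G T /\
  forall K, T K ->
    connected_in G
      ([set` K] `\` \bigcup_(L in [set L | T L /\ (L `<` K)%fset]) [set` L]).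

End Borel.

(* Main.v *)
(* The heart of the matter is an annulus property of the group, obtained without
   a structure theorem. Either at some scale the group looks like a line, and then
   some element acts as a translation along it and the group is a bounded
   neighbourhood of a cyclic subgroup, contradicting one-endedness; or geodesic
   tripods exist at every scale, and packing balls along them shows that volume
   grows superlinearly. With polynomial growth this yields arbitrarily large
   scales delta at which the volume of balls is comparable over a bounded ratio of
   radii and any two points of some sphere of radius m > 4 delta are joined outside
   the ball of radius 4 delta and inside a ball of radius c = O(delta): otherwise
   all translated geodesics between two big balls would cross a small ball, which
   is too small for that.

   In the space X, comparability of volumes provides, at each of a rapidly
   increasing sequence of scales, N Borel families of 3c-separated markers, N
   independent of the scale, which together come within 2 delta of every point. Some
   family comes near a given point at infinitely many scales, and the least such
   family depends only on the orbit; keeping that one, every edge is inside the ball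
   of radius 3 delta around a marker at some scale. The members of the toast are
   these balls, enlarged to absorb the balls of radius c around markers of smaller
   scales which they meet, and filled in. A path of a member that crosses a smaller
   member is rerouted in the annulus around the latter. *)

Require Import Defs.
From Stdlib Require Import Operators_Properties.
From mathcomp Require Import zify.
Local Open Scope classical_set_scope.

Set Implicit Arguments.
Unset Strict Implicit.
Unset Printing Implicit Defensive.

(** * Distances and paths in graphs *)

Section GraphDistance.
Variables (V : Type) (G : V -> V -> Prop).
Hypothesis Gsym : forall x y, G x y -> G y x.
Implicit Types (A B K : set V) (x y z p : V).

Lemma gball_reach (r : nat) K y :
  gball G r K y <-> exists2 x, K x & gball G r [set x] y.
Proof.
elim: r y => [|r IH] y /=.
  by split=> [Ky|[x Kx ->]//]; exists y.
split=> [[/IH[x Kx xy]|[z /IH[x Kx xz] zy]]|[x Kx [xy|[z xz zy]]]].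
- by exists x => //; left.
- by exists x => //; right; exists z.
- by left; apply/IH; exists x.
- by right; exists z => //; apply/IH; exists x.
Qed.

Lemma gball_le (r s : nat) K : r <= s -> gball G r K `<=` gball G s K.
Proof.
move=> /subnK <-; elim: (s - r) => [//|n IH] x Kx.
by rewrite addSn; left; apply: IH.
Qed.

Lemma gball_center (r : nat) x : gball G r [set x] x.
Proof. exact: (@gball_le 0). Qed.

Lemma gball_add (r s : nat) x y :
  gball G (r + s) [set x] y <->
  exists2 z, gball G r [set x] z & gball G s [set z] y.
Proof.
elim: s y => [|s IH] y.
  by rewrite addn0; split=> [xy|[z xz ->]//]; exists y.
rewrite addnS /=; split=> [[/IH[z xz zy]|[w /IH[z xz zw] wy]]|].
- by exists z => //; left.
- by exists z => //; right; exists w.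
- by move=> [z xz [zy|[w zw wy]]]; [left|right; exists w => //]; apply/IH; exists z.
Qed.

Lemma gball1 x y : gball G 1 [set x] y <-> x = y \/ G x y.
Proof.
by split=> [[->|[z ->]]|[->|xy]]; [left|right|left|right; exists x].
Qed.

Lemma gball_trans (r s : nat) x y z :
  gball G r [set x] y -> gball G s [set y] z -> gball G (r + s) [set x] z.
Proof. by move=> xy yz; apply/gball_add; exists y. Qed.

Lemma gball_sym (r : nat) x y : gball G r [set x] y -> gball G r [set y] x.
Proof.
elim: r y => [|r IH] y; first by move=> ->.
case=> [xy|[z xz zy]]; first by left; apply: IH.
have yz : gball G 1 [set y] z by apply/gball1; right; apply: Gsym.
by rewrite -add1n; apply: gball_trans yz (IH _ xz).
Qed.

Lemma gball_disjC K L : gball G 1 K `&` L = set0 -> gball G 1 L `&` K = set0.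
Proof.
move=> KL; rewrite -subset0 => x [/gball_reach[y Ly yx] Kx].
suff : (gball G 1 K `&` L) y by rewrite KL.
by split=> //; apply/gball_reach; exists x => //; apply: gball_sym.
Qed.

Lemma reachable_refl A x : reachable_in G A x x.
Proof. exact: rt_refl. Qed.

Lemma reachable_trans A x y z :
  reachable_in G A x y -> reachable_in G A y z -> reachable_in G A x z.
Proof. exact: rt_trans. Qed.

Lemma reachable_step A x y : A x -> A y -> G x y -> reachable_in G A x y.
Proof. by move=> Ax Ay xy; apply: rt_step. Qed.

Lemma reachable_sym A x y : reachable_in G A x y -> reachable_in G A y x.
Proof.
elim=> [u v [Au Av uv]|u|u v w _ IH1 _ IH2].
- by apply: reachable_step => //; apply: Gsym.
- exact: reachable_refl.
- exact: reachable_trans IH2 IH1.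
Qed.

Lemma reachable_sub A B x y : A `<=` B ->
  reachable_in G A x y -> reachable_in G B x y.
Proof.
move=> AB; elim=> [u v [/AB Au /AB Av uv]|u|u v w _ IH1 _ IH2].
- exact: reachable_step.
- exact: reachable_refl.
- exact: reachable_trans IH1 IH2.
Qed.

Lemma reachable_ind A (P : V -> Prop) x y :
  (forall u v, A u -> A v -> G u v -> P u -> P v) ->
  reachable_in G A x y -> P x -> P y.
Proof.
move=> step; elim=> [u v [Au Av uv]|//|u v w _ IH1 _ IH2 /IH1/IH2//].
exact: step.
Qed.

Lemma reachable_inv A (P : V -> Prop) x y :
  (forall u v, A u -> A v -> G u v -> P u -> P v) ->
  reachable_in G A x y -> P x -> reachable_in G (A `&` P) x y.
Proof.
move=> step xy Px.
suff : P y /\ reachable_in G (A `&` P) x y by case.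
apply: (@reachable_ind A (fun z => P z /\ reachable_in G (A `&` P) x z) x y) => //.
  move=> u v Au Av uv [Pu xu]; have Pv := step _ _ Au Av uv Pu.
  by split=> //; apply: reachable_trans xu _; apply: reachable_step.
by split=> //; apply: reachable_refl.
Qed.

Lemma ball_reach (r : nat) p y :
  gball G r [set p] y -> reachable_in G (gball G r [set p]) y p.
Proof.
elim: r y => [|r IH] y; first by move=> ->; apply: reachable_refl.
case=> [py|[z pz zy]].
  by apply: reachable_sub (IH _ py); apply: gball_le.
apply: (@reachable_trans _ _ z).
  by apply: reachable_step (Gsym zy); [right; exists z|left].
by apply: reachable_sub (IH _ pz); apply: gball_le.
Qed.

Lemma ball_connected (r : nat) p : connected_in G (gball G r [set p]).
Proof.
move=> x y px py; apply: (reachable_trans (ball_reach px)).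
exact: reachable_sym (ball_reach py).
Qed.

(* A path through a hole is rerouted inside the ring around it. *)
Lemma punctured_connected (I : Type) (D : set I) (B L : I -> set V) A :
    connected_in G A ->
    (forall i, D i -> gball G 1 (L i) `<=` B i) ->
    (forall i, D i -> B i `<=` A) ->
    (forall i, D i -> connected_in G (B i `\` L i)) ->
    (forall i j, D i -> D j -> B i `&` B j !=set0 -> i = j) ->
  connected_in G (A `\` \bigcup_(i in D) L i).
Proof.
move=> cA LB BA cR Bdisj x y [Ax nx] [Ay ny].
have LsubB i : D i -> L i `<=` B i.
  by move=> Di z Lz; apply: (LB _ Di); left.
set A' := A `\` _.
have RA i : D i -> B i `\` L i `<=` A'.
  move=> Di z [Bz Lz]; split; first exact: (BA _ Di).
  move=> [j Dj Ljz]; apply: Lz.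
  suff -> : i = j by [].
  by apply: Bdisj => //; exists z; split=> //; apply: LsubB.
(* While the path is inside a hole, the invariant keeps the whole ring around that hole reachable,
   so the path may leave the hole anywhere. *)
pose P v := (A' v -> reachable_in G A' x v) /\
  (forall i, D i -> L i v -> forall u, (B i `\` L i) u -> reachable_in G A' x u).
have : P y; last by case=> + _; apply.
apply: (@reachable_ind A _ x y _ (cA _ _ Ax Ay)); last first.
  split=> [_|i Di Lix]; first exact: reachable_refl.
  by exfalso; apply: nx; exists i.
move=> u v Au Av uv [Pu1 Pu2]; split.
  move=> A'v; have [[i Di Liu]|nu] := pselect ((\bigcup_(i in D) L i) u).
    apply: (Pu2 i Di Liu); split.
      by apply: (LB i Di); right; exists u.
    by move=> Liv; apply: A'v.2; exists i.
  apply: (@reachable_trans _ _ u); first by apply: Pu1.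
  by apply: reachable_step.
move=> i Di Liv w Rw.
have [[j Dj Lju]|nu] := pselect ((\bigcup_(i in D) L i) u).
  have ij : j = i.
    apply: Bdisj => //; exists v; split; last exact: LsubB.
    by apply: (LB j Dj); right; exists u.
  by apply: (Pu2 j Dj Lju); rewrite ij.
have Ru : (B i `\` L i) u.
  split; last by move=> Liu; apply: nu; exists i.
  by apply: (LB i Di); right; exists v => //; apply: Gsym.
apply: (@reachable_trans _ _ u); first by apply: Pu1.
by apply: reachable_sub (RA i Di) _; apply: (cR i Di).
Qed.

End GraphDistance.

(** * Hulls of separated centers *)

Section Hulls.
Variables (V : Type) (G : V -> V -> Prop).
Hypothesis Gsym : forall x y, G x y -> G y x.
Variables (Q : nat -> set V) (t beta b m c : nat -> nat).
Implicit Types (p q x y z : V).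

(** A set closed under [link n] contains every ball of a scale below [n] that it meets; [core] is
    the least such set containing the ball of radius [beta n]. *)
Definition link n x y := exists j, exists2 q, (j < n)%N /\ Q j q &
  gball G (c j) [set q] x /\ gball G (c j) [set q] y.

Definition core n p : set V :=
  [set y | exists2 x, gball G (beta n) [set p] x & clos_refl_trans V (link n) x y].

Definition sphere (r : nat) p : set V :=
  [set x | gball G r [set p] x /\ forall k, k < r -> ~ gball G k [set p] x].

(* The core together with the parts of the ball that it cuts off from the sphere. *)
Definition hull n p : set V :=
  [set y | gball G (m n) [set p] y /\
    forall z, sphere (m n) p z ->
      ~ reachable_in G (gball G (m n) [set p] `\` core n p) y z].

(** The core stays within radius [b n] ([core_b]), so these paths avoid it. *)
Definition annular n p := forall x y, sphere (m n) p x -> sphere (m n) p y ->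
  reachable_in G (gball G (c n) [set p] `\` gball G (b n) [set p]) x y.

(** [t n] bounds the displacement along a chain of balls of scales below [n]; a chain one level up
    is at most two of these with one ball of radius [c n] in between. *)
Hypothesis t_step : forall n, 2 * t n + 2 * c n <= t n.+1.
Hypothesis beta_b : forall n, beta n + t n <= b n.
Hypothesis b_m : forall n, b n < m n.
Hypothesis m_c : forall n, m n <= c n.
Hypothesis Qsep : forall n p q, Q n p -> Q n q ->
  gball G (2 * c n + t n) [set p] q -> p = q.
Hypothesis Qannular : forall n p, Q n p -> annular n p.
Hypothesis Qsphere : forall n p, Q n p -> sphere (m n) p !=set0.

(* A chain of overlapping balls visits at most one ball of the top level. *)
Lemma link_dist n x y : clos_refl_trans V (link n) x y -> gball G (t n) [set x] y.
Proof.
elim: n x y => [|n IH] x y.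
  move=> xy; suff -> : x = y by apply: gball_center.
  by elim: xy => [u v [j [q [+ _] _]]//|//|u v w _ -> _ ->].
move=> xy; set R := clos_refl_trans V (link n).
have Rsym u v : R u v -> R v u.
  elim=> [u' v' [j [q jq [qu qv]]]|u'|u' v' w _ IH1 _ IH2].
  - by apply: rt_step; exists j, q.
  - exact: rt_refl.
  - exact: rt_trans IH2 IH1.
(* Normal form of a chain: lower links only, or lower links, one top ball, lower links. A second top
   ball has the same center by [Qsep] and is merged with the first. *)
have : R x y \/ exists q u v, [/\ Q n q, R x u, R v y,
    gball G (c n) [set q] u & gball G (c n) [set q] v].
  elim/clos_refl_trans_ind_left: xy => [|u v xu Pu [j [q [jn Qq] [qu qv]]]].
    by left; apply: rt_refl.
  move: jn; rewrite ltnS leq_eqVlt => /orP[/eqP jn|jn]; last first.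
    have uv : R u v by apply: rt_step; exists j, q.
    case: Pu => [Rxu|[q' [u' [v' [Qq' xu' v'u qu' qv']]]]].
      by left; apply: rt_trans Rxu uv.
    by right; exists q', u', v'; split=> //; apply: rt_trans v'u uv.
  subst j.
  case: Pu => [Rxu|[q' [u' [v' [Qq' xu' v'u qu' qv']]]]].
    by right; exists q, u, v; split=> //; apply: rt_refl.
  have qq' : q = q'.
    apply: (Qsep Qq Qq').
    have -> : 2 * c n + t n = c n + t n + c n by lia.
    apply: (gball_trans (gball_trans qu (IH _ _ (Rsym _ _ v'u)))).
    exact: gball_sym.
  by right; exists q, u', v; split=> //; [apply: rt_refl|rewrite qq'].
move=> H; apply: gball_le (t_step n) _ _.
case: H => [Rxy|[q [u [v [Qq xu vy qu qv]]]]].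
  by apply: gball_le (IH _ _ Rxy); lia.
have -> : 2 * t n + 2 * c n = t n + (c n + c n) + t n by lia.
apply: gball_trans (IH _ _ vy).
apply: (gball_trans (IH _ _ xu)); apply: gball_trans qv.
exact: gball_sym.
Qed.

Lemma core_b n p : core n p `<=` gball G (b n) [set p].
Proof.
move=> y [x px /link_dist xy].
by apply: (gball_le (beta_b n)); apply: gball_trans px xy.
Qed.

Lemma sphere_core n p z : sphere (m n) p z -> ~ core n p z.
Proof. by move=> [_ mz] /core_b; apply: mz. Qed.

Lemma core_hull n p : core n p `<=` hull n p.
Proof.
move=> y Cy; split; first by apply: (gball_le (ltnW (b_m n))); apply: core_b.
move=> z Sz yz; have {}yz := clos_rt_rt1n _ _ _ _ yz.
by case: yz Sz => [/sphere_core//|u w [[_ nu]]].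
Qed.

Lemma hull_center n p : hull n p p.
Proof.
by apply: core_hull; exists p; [apply: gball_center|apply: rt_refl].
Qed.

Lemma hull_beta n p : gball G (beta n) [set p] `<=` hull n p.
Proof. by move=> y py; apply: core_hull; exists y => //; apply: rt_refl. Qed.

Lemma hull_m n p : hull n p `<=` gball G (m n) [set p].
Proof. by move=> y []. Qed.

Lemma hull_not_sphere n p y : hull n p y -> ~ sphere (m n) p y.
Proof. by move=> [_ h] Sy; apply: (h y Sy); apply: reachable_refl. Qed.

Lemma hull_interior n p : gball G 1 (hull n p) `<=` gball G (m n) [set p].
Proof.
move=> y [hy|[x hx xy]]; first exact: hull_m.
have [[k [km px]]|nx] := pselect (exists k, k < m n /\ gball G k [set p] x).
  by apply: (@gball_le _ _ k.+1 (m n)) => //; right; exists x.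
exfalso; apply: (hull_not_sphere hx); split; first by case: hx.
by move=> k km px; apply: nx; exists k.
Qed.

Lemma hull_c n p : gball G 1 (hull n p) `<=` gball G (c n) [set p].
Proof. by move=> y /hull_interior; apply: gball_le. Qed.

(** A path from [y] to the sphere off the core would extend to one from [x]. *)
Lemma hull_step n p x y : hull n p x -> G x y -> ~ core n p x -> ~ core n p y ->
  hull n p y.
Proof.
move=> hx xy ncx ncy.
have py : gball G (m n) [set p] y by apply: hull_interior; right; exists x.
split=> // z Sz yz; case: hx => px /(_ z Sz); apply.
by apply: reachable_trans yz; apply: reachable_step.
Qed.

(** A walk from a hull point towards [p] stays in the hull until it meets the core, by [hull_step].
    The core is connected because each link runs inside a connected ball. *)
Lemma hull_connected n p : connected_in G (hull n p).
Proof.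
have toB y r : r <= m n -> gball G r [set p] y -> hull n p y ->
    exists2 x, core n p x & reachable_in G (hull n p) x y.
  elim: r y => [|r IH] y rm.
    move=> -> _; exists p; last exact: reachable_refl.
    by exists p; [apply: gball_center|apply: rt_refl].
  move=> py hy; have [Cy|nCy] := pselect (core n p y).
    by exists y => //; apply: reachable_refl.
  case: py => [py|[z pz zy]]; first by apply: IH => //; lia.
  have hz : hull n p z.
    have [|nCz] := pselect (core n p z); first exact: core_hull.
    exact: hull_step hy (Gsym zy) nCy nCz.
  have [x Cx xz] := IH z (ltnW rm) pz hz.
  by exists x => //; apply: reachable_trans xz _; apply: reachable_step.
have coreP x : core n p x -> reachable_in G (core n p) p x.
  case=> y py yx; apply: (@reachable_trans _ _ _ _ y).
    apply: reachable_sub (reachable_sym Gsym (ball_reach Gsym py)).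
    by move=> z pz; exists z => //; apply: rt_refl.
  elim/clos_refl_trans_ind_left: yx => [|u v yu Pu uv]; first exact: reachable_refl.
  apply: (reachable_trans Pu); case: uv => j [q [jn Qq] [qu qv]].
  have := ball_connected Gsym qu qv; apply: reachable_sub => w qw.
  exists y => //; apply: rt_trans yu _; apply: rt_step.
  by exists j, q.
have toP y : hull n p y -> reachable_in G (hull n p) p y.
  move=> hy; have [//|x Cx xy] := toB y _ (leqnn _) _ hy; first by case: hy.
  by apply: reachable_trans xy; apply: reachable_sub (@core_hull n p) (coreP _ Cx).
move=> x y hx hy; apply: reachable_trans (toP _ hy).
exact: reachable_sym (toP _ hx).
Qed.

(** A ball meeting the core is linked into it; a ball missing the core is connected and cannot leave
    the hull, by [hull_step]. *)
Lemma hull_saturated n p j q : (j < n)%N -> Q j q ->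
  gball G (c j) [set q] `&` hull n p !=set0 -> gball G (c j) [set q] `<=` hull n p.
Proof.
move=> jn Qq [x [qx hx]] y qy.
have [[z [qz Cz]]|nC] := pselect (gball G (c j) [set q] `&` core n p !=set0).
  apply: core_hull; case: Cz => w pw wz; exists w => //.
  by apply: rt_trans wz _; apply: rt_step; exists j, q.
have {}nC z : gball G (c j) [set q] z -> ~ core n p z.
  by move=> qz Cz; apply: nC; exists z.
apply: (reachable_ind _ (ball_connected Gsym qx qy)) hx => u v qu qv uv hu.
by apply: hull_step hu uv _ _; apply: nC.
Qed.

(** Every ring point reaches the sphere: within radius [m n] because it is not in the hull, beyond
    it by walking towards [p]. Points of the sphere are joined by [annular]. *)
Lemma ring_connected n p : Q n p ->
  connected_in G (gball G (c n) [set p] `\` hull n p).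
Proof.
move=> Qp; set R := _ `\` _.
have mc x : gball G (m n) [set p] x -> gball G (c n) [set p] x by apply: gball_le.
have sphereR z : sphere (m n) p z -> R z.
  by move=> Sz; split; [apply: mc; case: Sz|move=> /hull_not_sphere].
have outer u z : sphere (m n) p z ->
    reachable_in G (gball G (m n) [set p] `\` core n p) u z -> ~ hull n p u.
  by move=> Sz uz [_ /(_ z Sz)]; apply.
have inner u z : sphere (m n) p z ->
    reachable_in G (gball G (m n) [set p] `\` core n p) u z -> reachable_in G R u z.
  move=> Sz uz; have {}uz := clos_rt_rt1n _ _ _ _ uz.
  elim: uz Sz => [w _|w v z' [Aw Av wv] vz IH Sz]; first exact: reachable_refl.
  have vz' := clos_rt1n_rt _ _ _ _ vz.
  apply: reachable_trans (IH Sz); apply: reachable_step => //.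
    split; first by apply: mc; case: Aw.
    apply: (outer _ z' Sz); apply: reachable_trans vz'; exact: reachable_step.
  by split; [apply: mc; case: Av|apply: (outer _ z' Sz)].
have toS u : R u -> exists2 z, sphere (m n) p z & reachable_in G R u z.
  case=> cu nu; have [mu|nmu] := pselect (gball G (m n) [set p] u).
    have : ~ (forall z, sphere (m n) p z ->
      ~ reachable_in G (gball G (m n) [set p] `\` core n p) u z) by move=> h; apply: nu.
    move=> /existsNP[z /not_implyP[Sz /contrapT uz]].
    by exists z => //; apply: inner.
  have {nu} : forall r, r <= c n -> gball G r [set p] u ->
      exists2 z, sphere (m n) p z & reachable_in G R u z.
    move=> r; elim: r u nmu cu {nu} => [|r IH] u nmu cu rc.
      by move=> pu; case: nmu; apply: gball_le pu.
    case=> [pu|[v pv vu]]; first by apply: IH => //; lia.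
    have cv : gball G (c n) [set p] v by apply: gball_le pv; lia.
    have Ru : R u by split=> // -[].
    have [mv|nmv] := pselect (gball G (m n) [set p] v).
      have Sv : sphere (m n) p v.
        split=> // k km pv'; apply: nmu; apply: (@gball_le _ _ k.+1) => //.
        by right; exists v.
      exists v => //; apply: reachable_step => //; [exact: sphereR|exact: Gsym].
    have [z Sz vz] := IH v nmv cv (ltnW rc) pv.
    exists z => //; apply: reachable_trans vz; apply: reachable_step => //.
      by split=> // -[].
    exact: Gsym.
  by apply; [exact: leqnn|].
(* The annular path starts off the hull and avoids the core, so by [hull_step] read backwards it
   never enters the hull. *)
have ring z z' : sphere (m n) p z -> sphere (m n) p z' -> reachable_in G R z z'.
  move=> Sz Sz'; have nhz : ~ hull n p z by move=> /hull_not_sphere.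
  have := @reachable_inv _ G _ (fun u => ~ hull n p u) z z' _
    (Qannular Qp Sz Sz') nhz.
  move=> H; apply: reachable_sub (H _) => [u [[cu _] nu] //|u v [cu bu] [cv bv] uv nu hv].
  have ncu : ~ core n p u by move/core_b.
  have ncv : ~ core n p v by move/core_b.
  by apply: nu; apply: hull_step hv (Gsym uv) ncv ncu.
move=> u v /toS[z Sz uz] /toS[z' Sz' vz'].
apply: (reachable_trans uz); apply: (reachable_trans (ring _ _ Sz Sz')).
exact: reachable_sym.
Qed.

Lemma hull_compare j q n p : Q j q -> Q n p -> (j < n)%N \/ j = n /\ q <> p ->
  gball G (c j) [set q] `&` hull n p = set0 \/ gball G (c j) [set q] `<=` hull n p.
Proof.
move=> Qq Qp [jn|[jn qp]].
  have [ne|/nonemptyPn e] := pselect (gball G (c j) [set q] `&` hull n p !=set0).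
    by right; apply: hull_saturated.
  by left.
subst j; left; rewrite -subset0 => x [qx hx]; apply: qp; apply: (Qsep Qq Qp).
have -> : 2 * c n + t n = c n + c n + t n by lia.
apply: gball_le (leq_addr _ _) _ _; apply: (gball_trans qx).
by apply: gball_sym => //; apply: hull_c; left.
Qed.

Lemma hull_toast n p n' p' : Q n p -> Q n' p' -> hull n p <> hull n' p' ->
  [\/ gball G 1 (hull n p) `&` hull n' p' = set0,
      gball G 1 (hull n p) `<=` hull n' p'
    | gball G 1 (hull n' p') `<=` hull n p].
Proof.
move=> Qp Qp' neq.
have lt_case : (n < n')%N \/ n = n' /\ p <> p' \/ (n' < n)%N.
  case: (ltngtP n n') => [|_|nn']; [by left|by right; right|right; left].
  by split=> // pp'; apply: neq; rewrite nn' pp'.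
have sub i x A : gball G (c i) [set x] `&` A = set0 -> gball G 1 (hull i x) `&` A = set0.
  by rewrite -!subset0 => h; apply: subset_trans h; apply: setSI; apply: hull_c.
rewrite orA in lt_case; case: lt_case => lt.
  have [/sub|h] := hull_compare Qp Qp' lt; first by constructor 1.
  by constructor 2; apply: subset_trans h; apply: hull_c.
have [/sub h|h] := hull_compare Qp' Qp (or_introl lt).
  by constructor 1; apply: gball_disjC.
by constructor 3; apply: subset_trans h; apply: hull_c.
Qed.

(** Holes are removed scale by scale, from the largest down, with [punctured_connected] applied at
    each scale. *)
Lemma hull_minus_connected n p : Q n p ->
  connected_in G (hull n p `\` \bigcup_(L in [set L | (exists j q, Q j q /\ L = hull j q) /\
    L `<=` hull n p /\ L <> hull n p]) L).
Proof.
move=> Qp; set K := hull n p.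
pose inside j := [set q | Q j q /\ gball G (c j) [set q] `<=` K].
(* The sphere of radius [m j] around [q] lies in the ball of radius [c j], hence in [K], but misses
   the hull of [q]. *)
have proper j q : inside j q -> hull j q `<=` K /\ hull j q <> K.
  move=> [Qq qK]; split; first by apply: subset_trans qK => x hx; apply: hull_c; left.
  move=> E; have [x Sx] := Qsphere Qq.
  suff : hull j q x by move/hull_not_sphere.
  by rewrite E; apply: qK; apply: (gball_le (m_c j)); case: Sx.
pose A j := K `\` \bigcup_(i in [set i | j <= i < n]) \bigcup_(q in inside i) hull i q.
suff {proper} : forall k j, (j + k)%N = n -> connected_in G (A j).
  move=> /(_ n 0%N (add0n n)); congr (connected_in G _); congr (_ `\` _).
  apply/seteqP; split=> [x [i _ [q Iq hx]]|x [L [[j [q [Qq ->]]] [LK neq]] hx]].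
    by exists (hull i q) => //; split; [exists i, q; case: Iq|apply: proper].
  (* Only hulls of smaller scale lie properly inside [K]: by [hull_compare], another hull of scale
     at least [n] misses the ball around [p] or contains it, and [K] with it. *)
  have hqq := hull_center j q; have cq : gball G (c j) [set q] q by apply: gball_center.
  have cp : K `<=` gball G (c n) [set p] by move=> y Ky; apply: hull_c; left.
  case: (ltngtP j n) => jn.
  - exists j => //.
    exists q => //; split=> //; have [d|//] := hull_compare Qq Qp (or_introl jn).
    suff : set0 q by []; rewrite -d; split=> //; exact: LK.
  - exfalso; have [d|nj] := hull_compare Qp Qq (or_introl jn).
      suff : set0 q by []; rewrite -d; split=> //; exact/cp/LK.
    by apply: neq; apply/seteqP; split=> //; apply: subset_trans nj.
  - exfalso; have qp : q <> p by move=> E; apply: neq; rewrite jn E.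
    have [d|nj] := hull_compare Qp Qq (or_intror (conj (esym jn) (nesym qp))).
      suff : set0 q by []; rewrite -d; split=> //; exact/cp/LK.
    by apply: neq; apply/seteqP; split=> //; apply: subset_trans nj.
elim=> [|k IH] j jk.
  suff -> : A j = K by apply: hull_connected.
  apply/seteqP; split=> [x []//|x Kx]; split=> // -[i /= ij]; lia.
have {}IH : connected_in G (A j.+1) by apply: IH; lia.
(* If the ball of [q] lies in [K] but not in [A j.+1], it meets a hole of larger scale and by
   [hull_compare] lies inside it, so its hull is already removed. *)
pose D := [set q | Q j q /\ gball G (c j) [set q] `<=` A j.+1].
have -> : A j = A j.+1 `\` \bigcup_(q in D) hull j q.
  apply/seteqP; split=> [x [Kx nx]|x [[Kx nx] nD]].
    split.
      split=> // -[i /= /andP[ji ilt] h]; apply: nx; exists i => //=.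
      by rewrite (ltnW ji).
    move=> [q [Qq qA] hx]; apply: nx; exists j; first by rewrite /=; lia.
    by exists q => //; split=> //; apply: subset_trans qA _; apply: subDsetl.
  split=> // -[i /= /andP[]]; rewrite leq_eqVlt => /orP[/eqP <- _|ji ilt h]; last first.
    by apply: nx; exists i => //=; rewrite ji.
  move=> [q [Qq qK] hx]; apply: nD; exists q => //; split=> // y qy; split; first exact: qK.
  move=> [i' /= /andP[ji ilt] [q' [Qq' q'K] hy]].
  have [d|sub] := hull_compare Qq Qq' (or_introl ji).
    suff : set0 y by []; rewrite -d; split=> //.
  apply: nx; exists i'; rewrite /= ?ji //; exists q' => //.
  by apply: sub; apply: hull_c; left.
apply: (@punctured_connected _ _ Gsym _ _ (fun q => gball G (c j) [set q])) => //.
- by move=> q _; apply: hull_c.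
- by move=> q [].
- by move=> q [Qq _]; apply: ring_connected.
move=> q q' [Qq _] [Qq' _] [y [qy q'y]]; apply: (Qsep Qq Qq').
have -> : 2 * c j + t j = c j + c j + t j by lia.
apply: gball_le (leq_addr _ _) _ _; apply: (gball_trans qy).
exact: gball_sym.
Qed.

End Hulls.

(** * Scales of polynomial superlinear growth *)

Section GrowthScales.
Variables (w : nat -> nat) (Q C d : nat).
Hypotheses (Q2 : (2 <= Q)%N) (w_gt0 : forall k, (0 < w k)%N).
Hypothesis w_poly : forall k, (w k <= C * Q ^ (d * k))%N.

(** By [w_poly] the quotient of [w j] by [Q ^ (d.+1 * j)] tends to 0, so from [J] on it attains a
    maximum. *)
Lemma suffix_maximum J : exists2 j, (J <= j)%N &
  forall k, (w (j + k) <= Q ^ (d.+1 * k) * w j)%N.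
Proof.
apply: contrapT => none.
have next j : (J <= j)%N -> exists k, (Q ^ (d.+1 * k) * w j < w (j + k))%N.
  move=> Jj; apply: contrapT => nk; apply: none; exists j => // k.
  by rewrite leqNgt; apply/negP => wk; apply: nk; exists k.
have grow r : exists2 j, (r + J <= j)%N & (Q ^ (d.+1 * (j - J)) * w J <= w j)%N.
  elim: r => [|r [j rj wj]]; first by exists J => //; rewrite subnn muln0 mul1n.
  have [|k wk] := next j; first by lia.
  have k0 : (0 < k)%N by case: k wk => //; rewrite muln0 mul1n addn0 ltnn.
  exists (j + k)%N; first by lia.
  apply: leq_trans (ltnW wk); rewrite (_ : (j + k - J = k + (j - J))%N); last by lia.
  by rewrite mulnDr expnD -mulnA leq_mul2l wj orbT.
(* For [j] beyond this bound, [j < Q ^ j] contradicts the consequence [Q ^ j <= C * Q ^ (d.+1 * J)]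
   of [w_poly]. *)
have [j rj wj] := grow (C * Q ^ (d.+1 * J))%N.
have : (Q ^ (d.+1 * j) <= C * Q ^ (d.+1 * J) * Q ^ (d * j))%N.
  have -> : (d.+1 * j = d.+1 * (j - J) + d.+1 * J)%N by rewrite -mulnDr subnK //; lia.
  rewrite expnD mulnAC leq_mul2r; apply/orP; right.
  apply: leq_trans (w_poly j); apply: leq_trans wj.
  by rewrite leq_pmulr.
rewrite mulSn expnD leq_pmul2r ?expn_gt0 ?(ltnW Q2) // leqNgt => /negP; apply.
by apply: leq_ltn_trans (ltn_expl j Q2); lia.
Qed.

Hypothesis w_superlinear : exists k0, forall k, (k0 <= k)%N -> (2 * Q * w k <= w k.+1)%N.

(* Scales j beyond which w never grows faster than the power d + 1; slightly
   above such a scale, superlinear growth has built up a large factor. *)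
Lemma growth_scale : exists I, forall J, exists j i, [/\ (J <= j)%N, (i <= I)%N,
  (w (j + 2 + i) <= Q ^ (d.+1 * (I + 2)) * w j)%N &
  (7 * Q ^ (1 + i) * w (j + 2 + i) * w (j + 1) <= 4 * w (j + 1 + i) ^ 2)%N].
Proof.
have Q0 : (0 < Q)%N := ltnW Q2.
(* Since [i1 < 2 ^ i1], this makes [2 ^ i1] exceed [2 * Q ^ (1 + 2 * al)]. *)
pose al := d.+1; have [i1 i1E] : exists i1, i1 = (2 * Q ^ (1 + 2 * al))%N by eexists.
exists (2 * i1 + 2)%N => J; have [k0 sup] := w_superlinear.
have [j Jj jmax] := suffix_maximum (J + k0).
(* Otherwise every step of this window multiplies [w] by more than [Q ^ (2 * al)]; the window covers
   more than half of the way from [j], so [jmax] is violated. *)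
have [i [i1i iI wi]] : exists i, [/\ (i1 <= i)%N, (i <= 2 * i1 + 2)%N &
    (w (j + 2 + i) <= Q ^ (2 * al) * w (j + 1 + i))%N].
  apply: contrapT => none.
  have up k : (k <= i1 + 3)%N -> (Q ^ (2 * al * k) * w (j + 1 + i1) <= w (j + 1 + i1 + k))%N.
    elim: k => [|k IH] k3; first by rewrite muln0 mul1n addn0.
    have {}IH := IH (ltnW k3); apply: leq_trans (_ : Q ^ (2 * al) * w (j + 1 + (i1 + k)) <= _)%N.
      by rewrite mulnS expnD -mulnA leq_mul2l addnA IH orbT.
    rewrite leqNgt; apply/negP => h; apply: none; exists (i1 + k)%N; split; try lia.
    apply: ltnW; rewrite (_ : (j + 2 + (i1 + k) = j + 1 + i1 + k.+1)%N) //; lia.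
  have := up _ (leqnn _); have := jmax (2 * i1 + 4)%N.
  rewrite (_ : (j + (2 * i1 + 4) = j + 1 + i1 + (i1 + 3))%N); last by lia.
  move=> h1 h2; have := leq_trans h2 h1; apply/negP; rewrite -ltnNge.
  have wlt k : (w j < w (j + k.+1))%N.
    have s k' : (w (j + k') < w (j + k'.+1))%N.
      rewrite addnS; apply: leq_trans (sup _ _); last by lia.
      have := w_gt0 (j + k'); nia.
    by elim: k => [|k IH]; [rewrite -{1}(addn0 j)|apply: ltn_trans IH (s _)].
  apply: leq_ltn_trans (_ : Q ^ (2 * al * (i1 + 3)) * w j < _)%N.
    rewrite leq_mul2r leq_pexp2l ?orbT // -mulnA mulnCA.
    by rewrite leq_mul2l; apply/orP; right; rewrite mulnDr leq_add2l.
  rewrite ltn_pmul2l ?expn_gt0 ?Q0 // -addnA; exact: wlt.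
exists j, i; split; [lia|lia| |].
  rewrite -addnA; apply: leq_trans (jmax _) _; rewrite leq_mul2r leq_pexp2l ?orbT // leq_mul2l.
  by rewrite addnC leq_add2r iI orbT.
(* Each step gains a factor [2 * Q]; after [i] steps the surplus [2 ^ i] over [Q ^ i] pays for
   [Q ^ (1 + 2 * al)]. *)
have low k : ((2 * Q) ^ k * w (j + 1) <= w (j + 1 + k))%N.
  elim: k => [|k IH]; first by rewrite mul1n addn0.
  have /sup : (k0 <= j + 1 + k)%N by lia.
  rewrite (addnS (j + 1)) => s; apply: leq_trans s.
  by rewrite expnS -mulnA leq_mul2l IH orbT.
apply: leq_trans (_ : 7 * Q ^ (1 + i) * (Q ^ (2 * al) * w (j + 1 + i)) * w (j + 1) <= _)%N.
  by rewrite leq_mul2r leq_mul2l wi !orbT.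
apply: leq_trans (_ : 4 * ((2 * Q) ^ i * w (j + 1)) * w (j + 1 + i) <= _)%N; last first.
  by rewrite -mulnn -mulnA leq_mul2l leq_mul2r low !orbT.
have two_i : (2 * Q ^ (1 + 2 * al) <= 2 ^ i)%N.
  by rewrite -i1E; apply: leq_trans i1i _; apply: ltnW; apply: ltn_expl.
have -> : (7 * Q ^ (1 + i) * (Q ^ (2 * al) * w (j + 1 + i)) * w (j + 1) =
  7 * Q ^ (1 + 2 * al) * (Q ^ i * (w (j + 1 + i) * w (j + 1))))%N.
  by rewrite !expnD; nia.
have -> : (4 * ((2 * Q) ^ i * w (j + 1)) * w (j + 1 + i) =
  4 * 2 ^ i * (Q ^ i * (w (j + 1 + i) * w (j + 1))))%N.
  by rewrite expnMn; nia.
by rewrite leq_mul2r; apply/orP; right; lia.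
Qed.

End GrowthScales.

(** * Geometry of word metrics *)

Section IntegerPowers.
Variable Gamma : groupType.
Local Open Scope group_scope.
Implicit Types (h : Gamma) (k l : int).

Definition zexpg h k : Gamma := if k is Negz n then h ^- n.+1 else h ^+ `|k|%N.

Lemma zexpgS h k : zexpg h (k + 1)%R = zexpg h k * h.
Proof.
case: k => [n|[|n]].
- by rewrite (_ : (Posz n + 1 = Posz n.+1)%R) /= ?expgSr //; lia.
- by rewrite (_ : (Negz 0 + 1 = 0)%R) //= expg1 mulVg.
- rewrite (_ : (Negz n.+1 + 1 = Negz n)%R); last by lia.
  by rewrite /= [in RHS]expgS invgM mulgVK.
Qed.

Lemma zexpgB h k : zexpg h (k - 1)%R = zexpg h k * h^-1.
Proof. by apply: (mulIg h); rewrite mulgVK -zexpgS GRing.subrK. Qed.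

Lemma zexpgD h k l : zexpg h (k + l)%R = zexpg h k * zexpg h l.
Proof.
elim/int_ind: l => [|n IH|n IH].
- by rewrite GRing.addr0 /= mulg1.
- by rewrite -addn1 PoszD GRing.addrA !zexpgS IH mulgA.
- rewrite -addn1 PoszD GRing.opprD GRing.addrA !zexpgB IH mulgA //.
Qed.

Lemma zexpgN h k : zexpg h (- k)%R = (zexpg h k)^-1.
Proof. by apply: (mulIg (zexpg h k)); rewrite -zexpgD GRing.addNr mulVg. Qed.

End IntegerPowers.

Section WordGeometry.
Variables (Gamma : groupType) (len : Gamma -> nat) (ball : nat -> {fset Gamma}).
Local Open Scope group_scope.
Implicit Types (g h x y z : Gamma) (n r : nat).

Hypothesis len0 : forall g, len g = 0%N -> g = 1.
Hypothesis len1 : len 1 = 0%N.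
Hypothesis lenV : forall g, len g^-1 = len g.
Hypothesis lenM : forall g h, (len (g * h) <= len g + len h)%N.
Hypothesis len_split : forall g k, (k <= len g)%N ->
  exists u w, [/\ g = u * w, len w = k & len u = (len g - k)%N].
Hypothesis mem_ball : forall g n, (g \in ball n) = (len g <= n)%N.
Hypothesis len_unbounded : forall n, exists g, (n <= len g)%N.

(** Generators multiply on the left in [cayley_graph], so this metric is invariant under right
    translations. *)
Definition dist x y := len (y * x^-1).

Lemma dist_refl x : dist x x = 0%N.
Proof. by rewrite /dist mulgV. Qed.

Lemma dist_sym x y : dist x y = dist y x.
Proof. by rewrite /dist -lenV invgM invgK. Qed.

Lemma dist_triangle y x z : (dist x z <= dist x y + dist y z)%N.
Proof.
rewrite /dist addnC; suff -> : z * x^-1 = (z * y^-1) * (y * x^-1) by apply: lenM.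
by rewrite mulgA mulgVK.
Qed.

Lemma dist_mulr g x y : dist (x * g) (y * g) = dist x y.
Proof. by rewrite /dist mulgKA. Qed.

Lemma dist1 g : dist 1 g = len g.
Proof. by rewrite /dist invg1 mulg1. Qed.

(** With truncated subtraction, the right-hand side is the absolute difference of [i] and [j]. *)
Definition geodesic (n : nat) (c : nat -> Gamma) := forall i j, (i <= n)%N -> (j <= n)%N ->
  dist (c i) (c j) = (i - j + (j - i))%N.

Lemma geodesic_exists x y : exists c : nat -> Gamma,
  [/\ c 0%N = x, c (dist x y) = y & geodesic (dist x y) c].
Proof.
have [n] : exists n, dist x y = n by eexists.
elim: n y => [|n IH] y xy.
  have -> : y = x by apply/(divg1_eq (x := y)); apply: len0.
  exists (fun=> x); rewrite dist_refl; split=> // i j; rewrite !leqn0 => /eqP-> /eqP->.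
  by rewrite dist_refl.
have [u [w [E lw lu]]] : exists u w, [/\ y * x^-1 = u * w, len w = n & len u = 1%N].
  have [//|u [w [E lw lu]]] := @len_split (y * x^-1) n; first by rewrite -/(dist x y) xy.
  by exists u, w; split=> //; rewrite lu -/(dist x y) xy subSnn.
have xz : dist x (w * x) = n by rewrite /dist mulgK.
have zy : dist (w * x) y = 1%N by rewrite /dist invgM mulgA E mulgK.
have [c [c0 cn cg]] := IH _ xz; rewrite xz in cn cg.
exists (fun i => if (i <= n)%N then c i else y); rewrite xy leq0n ltnn; split=> //.
have toy i : (i <= n)%N -> dist (c i) y = (n.+1 - i)%N.
  move=> ni; have := cg i n ni (leqnn n); have := cg 0%N i (leq0n n) ni.
  have := dist_triangle (c n) (c i) y; have := dist_triangle (c i) x y.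
  rewrite -c0 c0 cn xy zy; lia.
move=> i j iN jN; case: (leqP i n) => ni; case: (leqP j n) => nj.
- exact: cg.
- rewrite toy //; lia.
- rewrite dist_sym toy //; lia.
- rewrite dist_refl; lia.
Qed.

Lemma geodesic_shift n k r c : geodesic n c -> (k + r <= n)%N ->
  geodesic r (fun i => c (k + i)%N).
Proof. move=> cg krn i j ir jr; rewrite cg; lia. Qed.

Lemma geodesic_mulr n c g : geodesic n c -> geodesic n (fun i => c i * g).
Proof. by move=> cg i j ni nj; rewrite dist_mulr cg. Qed.

Lemma line_exists (L : nat) : exists2 c, geodesic (2 * L) c & c L = 1.
Proof.
have [g gl] := len_unbounded (2 * L); have [c [_ _]] := geodesic_exists 1 g.
rewrite dist1 => cg; exists (fun i => c i * (c L)^-1); last by rewrite mulgV.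
apply: geodesic_mulr; exact: (@geodesic_shift _ 0 _ _ cg).
Qed.

(** The balls of radius [n] around the [f i] are disjoint right translates inside the ball of radius
    [r + n] around [o]. *)
Lemma packing (I : finType) (f : I -> Gamma) o n r :
    (forall i, (dist o (f i) <= r)%N) ->
    (forall i j, i != j -> (2 * n < dist (f i) (f j))%N) ->
  (#|I| * #|` ball n| <= #|` ball (r + n)|)%N.
Proof.
move=> fr fsep.
have ln (u : ball n) : (len (val u) <= n)%N by rewrite -mem_ball; apply: fsvalP.
have bF (p : I * ball n) : val p.2 * f p.1 * o^-1 \in ball (r + n).
  rewrite mem_ball -mulgA addnC.
  by apply: leq_trans (lenM _ _) (leq_add (ln _) (fr p.1)).
pose F (p : I * ball n) : ball (r + n) := [` bF p]%fset.
rewrite !cardfE -card_prod; apply: (@leq_card _ _ F) => -[i u] [j w] /(congr1 val) /= /mulIg E.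
have ij : i = j.
  apply/eqP/negPn/negP => /fsep; apply/negP; rewrite -leqNgt.
  have -> : f j = (val w)^-1 * (val u * f i) by rewrite E mulKg.
  rewrite /dist mulgA mulgK (leq_trans (lenM _ _)) // lenV.
  by rewrite mul2n -addnn leq_add.
by rewrite {}ij in E *; congr (_, _); apply: val_inj; exact: mulIg E.
Qed.

(** The leg [e] leaves the midpoint of [c] perpendicularly: the midpoint is a nearest point of [c]
    to every [e s]. *)
Definition tripod w := exists c e : nat -> Gamma,
  [/\ geodesic (2 * w) c, geodesic w e, e 0%N = c w &
      forall s i, (s <= w)%N -> (i <= 2 * w)%N -> (s <= dist (e s) (c i))%N].

(* The two legs along a line would only give the factor 12. *)
Lemma tripod_growth n : (5 <= n)%N -> tripod (11 * n + 5) ->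
  (16 * #|` ball n| <= #|` ball (12 * n)|)%N.
Proof.
move=> n5 [c [e [cg eg e0 ec]]]; set w := (11 * n + 5)%N in cg eg e0 ec.
(* The branch point and five points on each leg, spaced by [2 * n + 1]. They lie within [10 * n + 5]
   of the branch point, and [11 * n + 5 <= 12 * n] because [5 <= n]. *)
pose f (k : 'I_16) : Gamma := if (k <= 10)%N then c (n + k * (2 * n + 1))%N
  else e ((k - 10) * (2 * n + 1))%N.
have near k : (dist (c w) (f k) <= 10 * n + 5)%N.
  rewrite /f; have := ltn_ord k; case: (leqP k 10) => k10 k16.
    rewrite cg; nia.
  rewrite -e0 eg; nia.
have sep (i j : 'I_16) : (i < j)%N -> (2 * n < dist (f i) (f j))%N.
  move=> ij; have := ltn_ord j; rewrite /f => j16.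
  case: (leqP j 10) => j10; first by rewrite (leq_trans (ltnW ij) j10) cg; nia.
  case: (leqP i 10) => i10; last by rewrite eg; nia.
  rewrite dist_sym; apply: leq_trans (ec _ _ _ _); nia.
have {}sep i j : i != j -> (2 * n < dist (f i) (f j))%N.
  by rewrite neq_ltn => /orP[/sep//|/sep]; rewrite dist_sym.
have := packing near sep; rewrite card_ord => /leq_trans; apply.
apply: fsubset_leq_card; apply/fsubsetP => g; rewrite !mem_ball => /leq_trans; apply; lia.
Qed.
(** Otherwise a geodesic from the nearest point of the line to [x] is the third leg of a tripod; [L]
    is large enough to keep that point at least [w] away from the ends. *)
Lemma not_tripod_near w L c x : ~ tripod w -> geodesic (2 * L) c -> c L = 1 ->
  (2 * len x + w <= L)%N -> exists2 i, (i <= 2 * L)%N & (dist x (c i) < w)%N.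
Proof.
move=> ntri cg cL xL.
have [i _ imin] := arg_minnP (P := predT) (fun i : 'I_(2 * L).+1 => dist x (c i))
  (erefl : predT (ord0 : 'I_(2 * L).+1)).
have iL : (i <= 2 * L)%N by rewrite -ltnS.
have [xi|wx] := ltnP (dist x (c i)) w; first by exists i.
have xmin k : (k <= 2 * L)%N -> (dist x (c i) <= dist x (c k))%N.
  by move=> kL; apply: (imin (Ordinal (kL : (k < (2 * L).+1)%N))).
have xlen : (dist x (c i) <= len x)%N.
  by rewrite -(dist1 x) (dist_sym 1) -cL; apply: xmin; lia.
have : dist 1 (c i) = (L - i + (i - L))%N by rewrite -cL cg //; lia.
have := dist_triangle x 1 (c i); rewrite !dist1 => tri iE.
exfalso; apply: ntri.
have [e [e0 ex eg]] := geodesic_exists (c i) x.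
exists (fun k => c (i - w + k)%N), e; split.
- apply: (geodesic_shift cg); lia.
- apply: (geodesic_shift (k := 0) eg); rewrite dist_sym; lia.
- by rewrite e0 subnK //; lia.
move=> s k sw kw; have kL : (i - w + k <= 2 * L)%N by lia.
have := xmin _ kL; have := dist_triangle (e s) x (c (i - w + k)%N).
have : dist x (e s) = (dist (c i) x - s)%N.
  rewrite -{1}ex dist_sym eg //; rewrite (dist_sym (c i)); lia.
rewrite (dist_sym (c i)); lia.
Qed.

(* A thin group is a line of bounded width, on which some element h acts as a
   translation: if c_(L+t) and c_(L-t) both act as reflections, then their
   quotient is a translation. *)
Lemma not_tripod_cyclic w : (0 < w)%N -> ~ tripod w ->
  exists h D, forall g, exists k : int, (len (g * zexpg h k) <= D)%N.
Proof.
move=> w0 ntri; pose L := (200 * w)%N; have [c cg cL] := line_exists L.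
pose P x i := (i <= 2 * L)%N /\ (dist x (c i) < w)%N.
have thick x : (len x <= 90 * w)%N -> exists i, P x i.
  move=> xw; have [|i iL xi] := not_tripod_near (x := x) ntri cg cL; first by lia.
  by exists i.
have Pc i : (i <= 2 * L)%N -> P (c i) i by move=> iL; split; rewrite ?dist_refl.
have P1 : P 1 L by rewrite -cL; apply: Pc; lia.
have Pdist x y i j : P x i -> P y j ->
    (dist x y < i - j + (j - i) + 2 * w)%N /\ (i - j + (j - i) < dist x y + 2 * w)%N.
  move=> [iL xi] [jL yj]; have := cg i j iL jL.
  have := dist_triangle (c i) x y; have := dist_triangle (c j) (c i) y.
  have := dist_triangle x (c i) (c j); have := dist_triangle y x (c j).
  rewrite (dist_sym (c i) x) (dist_sym (c j) y); lia.
have Plen x i : P x i -> (len x < i - L + (L - i) + 2 * w)%N /\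
    (i - L + (L - i) < len x + 2 * w)%N.
  by move=> Px; have := Pdist _ _ _ _ P1 Px; rewrite dist1; lia.
(* [h] and its inverse are to project to opposite sides of [1], which makes [h] a translation. *)
have [h [a [b [Pa Pb a_ge b_le ab]]]] : exists h a b, [/\ P h a, P h^-1 b,
    (L + 8 * w <= a)%N, (b + 8 * w <= L)%N & (a <= L + 22 * w /\ L <= b + 22 * w)%N].
  pose g := c (L + 10 * w)%N; pose g' := c (L - 10 * w)%N.
  have Pg : P g (L + 10 * w)%N by apply: Pc; lia.
  have Pg' : P g' (L - 10 * w)%N by apply: Pc; lia.
  have lg : len g = (10 * w)%N by rewrite -dist1 -cL cg; lia.
  have lg' : len g' = (10 * w)%N by rewrite -dist1 -cL cg; lia.
  have [|b Pb] := thick g^-1; first by rewrite lenV; lia.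
  have [|b' Pb'] := thick g'^-1; first by rewrite lenV; lia.
  have lh : len (g * g'^-1) = (20 * w)%N by rewrite -/(dist g' g) cg; lia.
  have [|a Pa] := thick (g * g'^-1); first by lia.
  have [|e Pe] := thick (g * g'^-1)^-1; first by rewrite lenV; lia.
  have := Plen _ _ Pb; have := Plen _ _ Pb'; rewrite !lenV lg lg' => lb' lb.
  have [bL|Lb] := leqP b L.
    exists g, (L + 10 * w)%N, b; split=> //; lia.
  have [Lb'|b'L] := leqP L b'.
    exists g'^-1, b', (L - 10 * w)%N; rewrite invgK; split=> //; lia.
  have := Plen _ _ Pa; have := Plen _ _ Pe; rewrite lenV lh => le la.
  have := Pdist _ _ _ _ Pb' Pa; rewrite {1 2}/dist invgK mulgVK lg => dba.
  have := Pdist _ _ _ _ Pb Pe.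
  rewrite {1 2}/dist invgK invgM invgK mulgVK lg' => dbe.
  exists (g * g'^-1)^-1, e, a; rewrite invgK; split=> //; lia.
exists h, (50 * w)%N.
(* [x] lies beyond [h] or beyond [h^-1] on the line; right division by the one on its side moves it
   inwards, as [len (x * h^-1)] is the distance from [h] to [x]. *)
have inward x : len x = (50 * w + 1)%N ->
    (len (x * h) <= 50 * w)%N \/ (len (x * h^-1) <= 50 * w)%N.
  move=> xD; have [|i Pi] := thick x; first by lia.
  have := Plen _ _ Pi; rewrite xD => li; case: (leqP L i) => iL.
    right; have := Pdist _ _ _ _ Pa Pi; rewrite /dist; lia.
  left; have := Pdist _ _ _ _ Pb Pi; rewrite /dist invgK; lia.
move=> g; have [n] : exists n, len g = n by eexists.
(* With one generator split off, a power of [h] carries the rest into the ball of radius [50 * w];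
   the product then has length at most [50 * w + 1], and one more factor suffices. *)
elim: n g => [|n IH] g gn; first by exists 0%R; rewrite /= expg0 mulg1 gn.
have [|u [v [E vn un]]] := @len_split g n; first by lia.
subst g.
have [k vk] := IH _ vn; have := lenM u (v * zexpg h k).
have [uvk _|uvk uvk'] := leqP (len (u * (v * zexpg h k))) (50 * w).
  by exists k; rewrite -mulgA.
have [|h1|h1] := inward (u * (v * zexpg h k)); first by lia.
  by exists (k + 1)%R; rewrite zexpgS !mulgA in h1 *.
by exists (k - 1)%R; rewrite zexpgB !mulgA in h1 *.
Qed.

Variable adj : Gamma -> Gamma -> Prop.
Hypothesis adjE : forall x y, adj x y <-> dist x y = 1%N.

Lemma geodesic_reach (A : set Gamma) n c : geodesic n c ->
  (forall i, (i <= n)%N -> A (c i)) -> reachable_in adj A (c 0%N) (c n).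
Proof.
elim: n => [|n IH] cg cA; first exact: rt_refl.
apply: (rt_trans _ _ _ (c n)).
  apply: IH => [i j ni nj|i ni]; [apply: cg|apply: cA]; exact: leqW.
apply: rt_step; split; [exact: cA|exact: cA|apply/adjE; rewrite cg //; lia].
Qed.

(* If x and y are not joined in the annulus, then every translated geodesic
   from the q-ball of x to the q-ball of y stays for at least b + 1 steps in
   the ball of radius 2b, and such a step determines the pair of end points. *)
Lemma annulus_reach q b x y : (2 * b < q)%N -> len x = (2 * q)%N -> len y = (2 * q)%N ->
  (#|` ball (6 * q)| * (6 * q).+1 * #|` ball (2 * b)| < #|` ball q| ^ 2 * b.+1)%N ->
  reachable_in adj [set z | (b < len z <= 9 * q)%N] x y.
Proof.
move=> bq xq yq count; apply: contrapT => nreach; set A := [set z | _] in nreach.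
have adj_sym u v : adj u v -> adj v u by move=> /adjE; rewrite dist_sym => /adjE.
have len_dist u v : (len v <= len u + dist u v)%N.
  by rewrite -!dist1; apply: dist_triangle.
have near o u : len o = (2 * q)%N -> (dist o u <= q)%N -> reachable_in adj A o u.
  move=> oq ou; have [c [c0 cn cg]] := geodesic_exists o u.
  rewrite -c0 -cn; apply: (geodesic_reach cg) => i iou; rewrite /A /=.
  have := len_dist o (c i); have := len_dist (c i) o; rewrite (dist_sym (c i)).
  rewrite -{2 4}c0 (cg 0%N i) //; lia.
have /choice[gam gamP] : forall z, exists c : nat -> Gamma,
    [/\ c 0%N = 1, c (len z) = z & geodesic (len z) c].
  by move=> z; have := geodesic_exists 1 z; rewrite dist1.
have lq (u : ball q) : (len (val u) <= q)%N by rewrite -mem_ball; apply: fsvalP.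
pose zz (p : ball q * ball q) := (val p.2 * y) * (val p.1 * x)^-1.
pose pt p i := gam (zz p) i * (val p.1 * x).
have pt_dist p i j : (i <= len (zz p))%N -> (j <= len (zz p))%N ->
    dist (pt p i) (pt p j) = (i - j + (j - i))%N.
  by move=> ni nj; rewrite /pt dist_mulr; case: (gamP (zz p)) => _ _ ->.
have pt0 p : pt p 0%N = val p.1 * x by rewrite /pt; case: (gamP (zz p)) => -> _ _; rewrite mul1g.
have ptn p : pt p (len (zz p)) = val p.2 * y.
  by rewrite /pt; case: (gamP (zz p)) => _ -> _; rewrite mulgVK.
have du o (u : ball q) : (dist o (val u * o) <= q)%N by rewrite /dist mulgK.
have lenz p : (len (zz p) <= 6 * q)%N.
  rewrite -/(dist (val p.1 * x) (val p.2 * y)).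
  have := dist_triangle x (val p.1 * x) (val p.2 * y).
  have := dist_triangle y x (val p.2 * y); have := dist_triangle 1 x y.
  rewrite (dist_sym _ x) (dist_sym x 1) !dist1 xq yq.
  have := du x p.1; have := du y p.2; lia.
(* A translated geodesic missing the ball of radius [b] would join the two big balls inside [A];
   [i0 p] is a time at which it is in that ball. *)
have /choice[i0 i0P] : forall p, exists i, (i <= len (zz p))%N /\ (len (pt p i) <= b)%N.
  move=> p; apply: contrapT => /forallNP far; apply: nreach.
  apply: (rt_trans _ _ _ (val p.1 * x)); first exact: near.
  apply: (rt_trans _ _ _ (val p.2 * y)); last by apply: reachable_sym => //; apply: near.
  rewrite -pt0 -ptn; apply: geodesic_reach; first exact: pt_dist.
  move=> i iz; rewrite /A /= ltnNge; apply/andP; split.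
    by apply/negP => ib; apply: (far i).
  have := len_dist (pt p 0%N) (pt p i); have := len_dist (pt p (len (zz p))) (pt p i).
  rewrite !pt_dist // pt0 ptn; have := len_dist x (val p.1 * x).
  have := len_dist y (val p.2 * y); have := du x p.1; have := du y p.2.
  have := lenz p; lia.
(* The end point has length at least [q], more than [2 * b], so at least [b] steps remain after
   [i0 p]. *)
have i0k p k : (k <= b)%N ->
    (i0 p + k <= len (zz p))%N /\ (len (pt p (i0 p + k)) <= 2 * b)%N.
  move=> kb; have [iz ib] := i0P p.
  have iz' : (i0 p + k <= len (zz p))%N.
    have := len_dist (pt p (i0 p)) (pt p (len (zz p))); rewrite pt_dist // ptn.
    have := len_dist (val p.2 * y) y; have := du y p.2; rewrite dist_sym; lia.
  split=> //; have := len_dist (pt p (i0 p)) (pt p (i0 p + k)).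
  rewrite pt_dist //; lia.
have b1 p : zz p \in ball (6 * q) by rewrite mem_ball.
have b2 (p : ball q * ball q) (k : 'I_b.+1) : (i0 p + k < (6 * q).+1)%N.
  rewrite ltnS; apply: leq_trans (lenz p); have := i0k p k; have := ltn_ord k; lia.
have b3 (p : ball q * ball q) (k : 'I_b.+1) : pt p (i0 p + k) \in ball (2 * b).
  rewrite mem_ball; have := i0k p k; have := ltn_ord k; lia.
(* The displacement fixes the geodesic out of [1]; the time and the position reached then give its
   translation, hence both end points. *)
pose F (t : ball q * ball q * 'I_b.+1) : ball (6 * q) * 'I_(6 * q).+1 * ball (2 * b) :=
  ([` b1 t.1]%fset, Ordinal (b2 t.1 t.2), [` b3 t.1 t.2]%fset).
have : (#|{: ball q * ball q * 'I_b.+1}| <= #|{: ball (6 * q) * 'I_(6 * q).+1 * ball (2 * b)}|)%N.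
  apply: (@leq_card _ _ F) => -[p k] [p' k'] [Ez Ei Ep].
  have E1 : p.1 = p'.1.
    by apply/val_inj/(mulIg x); move: Ep; rewrite /pt Ez Ei => /mulgI.
  have E2 : p.2 = p'.2.
    by apply/val_inj/(mulIg y); move: Ez; rewrite /zz E1 => /mulIg.
  have pp' : p = p' by case: p p' E1 E2 {Ez Ei Ep} => [? ?] [? ?] /= -> ->.
  subst p'; congr (_, _); apply: val_inj; move: Ei => /addnI //.
rewrite !card_prod !card_ord -!cardfE; lia.
Qed.

End WordGeometry.

(** * Word length *)

Section SchreierBalls.
Variables (Gamma : groupType) (S : set Gamma).
Local Open Scope group_scope.
Implicit Types g h : Gamma.

Lemma schreier_sym (X : Type) (a : Gamma -> X -> X) x y :
  schreier_graph S a x y -> schreier_graph S a y x.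
Proof. by move=> [xy [s Ss H]]; split=> [/esym//|]; exists s => //; case: H; [right|left]. Qed.

Lemma left_mul_action : is_action (fun g x : Gamma => g * x).
Proof. by split=> [x|g h x]; rewrite ?mul1g ?mulgA. Qed.

Definition wordball n : set Gamma := gball (cayley_graph S) n [set 1].

Lemma schreier_step (X : Type) (a : Gamma -> X -> X) x y : is_action a ->
  schreier_graph S a x y -> exists2 s, wordball 1 s & y = a s x.
Proof.
move=> [a1 aM] [xy [s Ss [yE|xE]]].
  exists s => //; apply/gball1; have [->|s1] := eqVneq s 1; first by left.
  by right; split; [apply/eqP; rewrite eq_sym|exists s => //; left; rewrite mulg1].
have yE : y = a s^-1 x by rewrite xE -aM mulVg a1.
exists s^-1 => //; apply/gball1; have [E|s1] := eqVneq s 1; first by left; rewrite E invg1.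
right; split; first by apply/eqP; rewrite eq_sym invg_eq1.
by exists s => //; right; rewrite mulgV.
Qed.

Lemma wordball1_step (X : Type) (a : Gamma -> X -> X) s x : is_action a ->
  wordball 1 s -> x = a s x \/ schreier_graph S a x (a s x).
Proof.
move=> [a1 aM] /gball1[<-|[s1 [t St ts]]]; first by left; rewrite a1.
have [|neq] := pselect (x = a s x); [by left|right; split=> //; exists t => //].
case: ts => [->|E]; first by left; rewrite mulg1.
by right; rewrite -aM -E a1.
Qed.

Lemma wordballM1 n s g : wordball 1 s -> wordball n g -> wordball n.+1 (s * g).
Proof.
move=> /(@wordball1_step _ _ _ g left_mul_action) [<-|sg] ng; first by left.
by right; exists g.
Qed.

Lemma gball_schreier (X : Type) (a : Gamma -> X -> X) n x y : is_action a ->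
  gball (schreier_graph S a) n [set x] y <-> exists2 g, wordball n g & y = a g x.
Proof.
move=> act; have [a1 aM] := act; elim: n y => [|n IH] y /=.
  by split=> [->|[g -> ->]]; rewrite /wordball ?a1 //; exists 1 => //; rewrite a1.
split=> [[/IH[g ng ->]|[z /IH[g ng ->] /(schreier_step act)[s s1 ->]]]|[g [ng|[h nh hg]] ->]].
- by exists g => //; left.
- by exists (s * g); rewrite ?aM //; apply: wordballM1.
- by left; apply/IH; exists g.
- have [s s1 ->] := schreier_step left_mul_action hg.
  have ah : gball (schreier_graph S a) n [set x] (a h x) by apply/IH; exists h.
  have [E|st] := wordball1_step (a h x) act s1; rewrite aM; first by rewrite -E; left.
  by right; exists (a h x).
Qed.

Lemma gball_cayley n x y : gball (cayley_graph S) n [set x] y <-> wordball n (y * x^-1).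
Proof.
rewrite /cayley_graph (gball_schreier n x y left_mul_action); split=> [[g ng ->]|ng].
  by rewrite mulgK.
by exists (y * x^-1) => //; rewrite mulgVK.
Qed.

Hypotheses (finS : finite_set S) (genS : generates S).

Let csym := @schreier_sym Gamma (fun g x => g * x).

Lemma wordballM m n g h : wordball m g -> wordball n h -> wordball (m + n) (g * h).
Proof.
move=> mg nh; rewrite addnC; apply: (gball_trans nh).
by apply/gball_cayley; rewrite mulgK.
Qed.

Lemma wordballV n g : wordball n g -> wordball n g^-1.
Proof. by move/(gball_sym csym)/gball_cayley; rewrite mul1g. Qed.

Lemma wordball_exists g : exists n, `[< wordball n g >].
Proof.
suff : (\bigcup_n wordball n) g by move=> [n _ ng]; exists n; apply/asboolP.
suff -> : \bigcup_n wordball n = setT by [].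
apply: genS; first by exists 0%N.
- by move=> x y [m _ mx] [n _ ny]; exists (m + n)%N => //; apply: wordballM.
- by move=> x [n _ nx]; exists n => //; apply: wordballV.
move=> s Ss; exists 1%N => //; apply/gball1; have [->|s1] := eqVneq s 1; first by left.
by right; split; [apply/eqP; rewrite eq_sym|exists s => //; left; rewrite mulg1].
Qed.

Definition wordlen g := ex_minn (wordball_exists g).

Lemma wordballE n g : wordball n g <-> (wordlen g <= n)%N.
Proof.
rewrite /wordlen; case: ex_minnP => k /asboolP kg kmin; split=> [ng|kn].
  exact/kmin/asboolP.
exact: gball_le kg.
Qed.

Lemma wordball_finite n : finite_set (wordball n).
Proof.
elim: n => [|n IH]; first exact: finite_set1.
pose T := S `|` [set s^-1 | s in S].
apply: (@sub_finite_set _ _ (wordball n `|` \bigcup_(s in T) [set s * g | g in wordball n])).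
  move=> y [|[x nx [_ [s Ss [->|E]]]]]; [by left|right|right].
    by exists s; [left|exists x].
  exists s^-1; first by right; exists s.
  by exists x => //; rewrite E mulKg.
rewrite finite_setU; split=> //; apply: bigcup_finite => [|s _].
  by rewrite finite_setU; split=> //; apply: finite_image.
exact: finite_image.
Qed.

Definition wball n : {fset Gamma} := fset_set (wordball n).

Lemma mem_wball g n : (g \in wball n) = (wordlen g <= n)%N.
Proof.
rewrite /wball in_fset_set; last exact: wordball_finite.
by apply/idP/idP; rewrite inE => /wordballE.
Qed.

Lemma wordlen0 g : wordlen g = 0%N -> g = 1.
Proof. by move=> g0; have /wordballE : (wordlen g <= 0)%N by rewrite g0. Qed.

Lemma wordlen1 : wordlen 1 = 0%N.
Proof. by apply/eqP; rewrite -leqn0; apply/wordballE. Qed.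

Lemma wordlenV g : wordlen g^-1 = wordlen g.
Proof.
have le x : (wordlen x^-1 <= wordlen x)%N by apply/wordballE/wordballV/wordballE.
by apply/eqP; rewrite eqn_leq le /= -{1}(invgK g) le.
Qed.

Lemma wordlenM g h : (wordlen (g * h) <= wordlen g + wordlen h)%N.
Proof. by apply/wordballE; apply: wordballM; apply/wordballE. Qed.

Lemma wordlen_split g k : (k <= wordlen g)%N ->
  exists u v, [/\ g = u * v, wordlen v = k & wordlen u = (wordlen g - k)%N].
Proof.
move=> kg; have : wordball (k + (wordlen g - k)) g by rewrite subnKC //; apply/wordballE.
move=> /gball_add[v kv /gball_cayley gv].
have := wordlenM (g * v^-1) v; rewrite mulgVK => le.
have {}gv := (wordballE _ _).1 gv; have {}kv := (wordballE k v).1 kv.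
by exists (g * v^-1), v; rewrite mulgVK; split=> //; lia.
Qed.

Lemma cayley_dist x y : cayley_graph S x y <-> dist wordlen x y = 1%N.
Proof.
have := gball_cayley 1 x y; rewrite gball1 wordballE /dist => E.
split=> [xy|d1].
  have /E : x = y \/ cayley_graph S x y by right.
  suff : wordlen (y * x^-1) <> 0%N by lia.
  by move=> /wordlen0/divg1_eq yx; case: xy => + _; apply.
have /E[xy|//] : (wordlen (y * x^-1) <= 1)%N by rewrite d1.
by move: d1; rewrite xy mulgV wordlen1.
Qed.

End SchreierBalls.

Lemma finite_nat_bound (A : set nat) : finite_set A ->
  exists B, forall n, A n -> (n <= B)%N.
Proof.
move=> /finite_fsetP[X ->]; exists (\max_(x <- X) x) => n Xn.
exact: (@leq_bigmax_seq _ _ xpredT id).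
Qed.

(** * One-ended groups are not bounded neighbourhoods of cyclic subgroups *)

Section OneEndedGroups.
Variables (Gamma : groupType) (S : set Gamma).
Hypotheses (finS : finite_set S) (genS : generates S).
Hypothesis ends : one_ended (cayley_graph S).
Local Open Scope group_scope.
Implicit Types g h x y : Gamma.
Local Notation len := (wordlen genS).

Lemma wordlen_unbounded n : exists g, (n <= len g)%N.
Proof.
apply: contrapT => /forallNP bounded.
have [C [[_ infC] _]] := ends.2 set0 (finite_set0 _).
apply: infC; apply: (@sub_finite_set _ _ (wordball S n)); last exact: wordball_finite.
by move=> g _; apply/(wordballE genS); have := bounded g; lia.
Qed.

Section CyclicBoundedIndex.
Variables (h : Gamma) (D : nat).
Hypothesis cyc : forall g, exists k : int, (len (g * zexpg h k) <= D)%N.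

(** If a positive power of [h] were trivial, all powers would be bounded and, by [cyc], so would the
    group. *)
Lemma zexpg_inj : injective (zexpg h).
Proof.
have lenX n : (len (h ^+ n) <= n * len h)%N.
  elim: n => [|n IH]; first by rewrite expg0 wordlen1.
  by rewrite expgS mulSn (leq_trans (wordlenM _ _ _)) // leq_add2l.
have noroot m : (0 < m)%N -> h ^+ m <> 1.
  move=> m0 hm; have [g] := wordlen_unbounded (D + m * len h).+1.
  have [k gk] := cyc g; suff : (len (zexpg h k) <= m * len h)%N.
    have := wordlenM genS (g * zexpg h k) (zexpg h k)^-1; rewrite mulgK wordlenV; lia.
  have hmod n : (len (h ^+ n) <= m * len h)%N.
    rewrite (divn_eq n m) mulnC expgnDr expgnA hm expg1n mul1g.
    by apply: leq_trans (lenX _) _; rewrite leq_mul2r (ltnW (ltn_pmod n m0)) orbT.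
  by case: k {gk} => n /=; rewrite ?wordlenV.
have pos k l : zexpg h k = zexpg h l -> (k <= l)%R -> k = l.
  move=> kl le; have : zexpg h (l - k)%R = 1 by rewrite zexpgD zexpgN kl mulgV.
  have [n lkn] : exists n : nat, (l - k)%R = n by exists `|l - k|%N; lia.
  rewrite lkn /=; case: n lkn => [|n] lkn hn; first by lia.
  by exfalso; apply: (@noroot n.+1).
move=> k l kl; have [le|le] : (k <= l)%R \/ (l <= k)%R by lia.
  exact: pos.
by apply/esym; apply: pos.
Qed.

Lemma zexpg_bound N : exists A : nat, forall k, (len (zexpg h k) <= N)%N -> (`|k| <= A)%N.
Proof.
have fin : finite_set (zexpg h @^-1` wordball S N).
  by apply: finite_preimage (wordball_finite finS N) => k l _ _; apply: zexpg_inj.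
have {}fin : finite_set ((fun k : int => `|k|%N) @` (zexpg h @^-1` wordball S N)).
  exact: finite_image.
have [A AP] := finite_nat_bound fin.
by exists A => k kN; apply: AP; exists k => //; apply/wordballE.
Qed.

End CyclicBoundedIndex.

(** The exponent [e x] of a power of [h] near [x] is a coarse coordinate. It changes by at most [A]
    along edges and exceeds [A] in absolute value off a large ball, so its sign is constant on
    components there, and the two rays of powers of [h] lie in different infinite components. *)
Lemma one_ended_not_cyclic :
  ~ exists h D, forall g, exists k : int, (len (g * zexpg h k) <= D)%N.
Proof.
move=> [h [D cyc]]; have cayS := @schreier_sym _ S _ (fun g x => g * x).
have /choice[e eP] : forall x, exists k, (len (x * (zexpg h k)^-1) <= D)%N.
  by move=> x; have [k xk] := cyc x; exists (- k)%R; rewrite zexpgN invgK.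
have [A AP] := zexpg_bound cyc (2 * D + 1).
have eh k : (`|k - e (zexpg h k)| <= A)%N.
  apply: AP; rewrite zexpgD zexpgN; have := eP (zexpg h k); lia.
have [M MP] : exists M, forall k, (`|k| <= A)%N -> (len (zexpg h k) <= M)%N.
  elim: A {AP eh} => [|A [M MP]].
    by exists (len (zexpg h 0)) => k; rewrite leqn0 absz_eq0 => /eqP ->.
  exists (maxn M (maxn (len (zexpg h A.+1)) (len (zexpg h (- A.+1%:Z)%R)))) => k kA.
  rewrite !leq_max; have [/MP ->//|Ak] := leqP `|k|%N A.
  have [->|->] : k = A.+1 \/ k = (- A.+1%:Z)%R by lia.
    by rewrite leqnn orbT.
  by rewrite leqnn !orbT.
pose F := wordball S (D + M).
have outF x : (~` F) x -> (A < `|e x|)%N.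
  move=> Fx; rewrite ltnNge; apply/negP => /MP eM; apply: Fx; apply/(wordballE genS).
  have := wordlenM genS (x * (zexpg h (e x))^-1) (zexpg h (e x)); rewrite mulgVK.
  have := eP x; lia.
have step x y : cayley_graph S x y -> (`|e y - e x| <= A)%N.
  move=> /(cayley_dist genS) xy; apply: AP; rewrite zexpgD zexpgN.
  have -> : zexpg h (e y) * (zexpg h (e x))^-1 =
      (y * (zexpg h (e y))^-1)^-1 * (y * x^-1) * (x * (zexpg h (e x))^-1).
    by rewrite invgM invgK !mulgA !mulgVK.
  have := wordlenM genS ((y * (zexpg h (e y))^-1)^-1 * (y * x^-1)) (x * (zexpg h (e x))^-1).
  have := wordlenM genS ((y * (zexpg h (e y))^-1)^-1) (y * x^-1).
  have := eP x; have := eP y; rewrite wordlenV -/(dist len x y) xy => h1 h2 h3 h4.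
  apply: leq_trans h4 _; apply: leq_trans (leq_add (leq_trans h3 (leq_add h1 (leqnn 1))) h2) _.
  lia.
have sign x y : reachable_in (cayley_graph S) (~` F) x y -> (0 < e x)%R -> (0 < e y)%R.
  apply: (@reachable_ind _ _ _ (fun z => (0 < e z)%R)) => u v Fu Fv /step; have := outF _ Fu; have := outF _ Fv; lia.
(* A geodesic between consecutive powers has length [len h], so beyond exponent [B] it misses
   [F]. *)
have [B BP] := zexpg_bound cyc (D + M + len h).
have ray k : (B < `|k|)%N ->
    reachable_in (cayley_graph S) (~` F) (zexpg h k) (zexpg h (k + 1)%R).
  move=> Bk; have [c [c0 cn cg]] := geodesic_exists (@wordlen0 _ _ genS) (wordlen1 genS)
    (@wordlenV _ _ genS) (@wordlenM _ _ genS) (@wordlen_split _ _ genS)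
    (zexpg h k) (zexpg h (k + 1)%R).
  have := geodesic_reach (wordlen1 genS) (cayley_dist genS) (A := ~` F) cg; rewrite c0 cn; apply => i ni.
  move=> /(wordballE genS) ciF; suff : (`|k| <= B)%N by lia.
  apply: BP; have := cg i 0%N ni (leq0n _); rewrite c0.
  have : dist len (zexpg h k) (zexpg h (k + 1)%R) = len h.
    rewrite -(dist_mulr len (zexpg h (- k)%R)) -!zexpgD GRing.subrr.
    by rewrite GRing.addrAC GRing.subrr /dist /= expg0 invg1 mulg1 expg1.
  move=> dh; have := wordlenM genS (c i * (zexpg h k)^-1)^-1 (c i).
  rewrite wordlenV invgM invgK mulgVK -/(dist len (zexpg h k) (c i)) dist_sym; last exact: wordlenV.
  rewrite dh in ni *; lia.
have outB k : (B < `|k|)%N -> (~` F) (zexpg h k).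
  move=> Bk /(wordballE genS) kF; suff : (`|k| <= B)%N by lia.
  by apply: BP; lia.
(* Beyond [B] the rays avoid [F]; beyond [A] the coordinate has the sign of the exponent, by
   [eh]. *)
pose k0 := (A + B).+1.
have up n : reachable_in (cayley_graph S) (~` F) (zexpg h k0) (zexpg h (k0 + n)%N).
  elim: n => [|n IH]; first by rewrite addn0; apply: reachable_refl.
  apply: reachable_trans IH _; rewrite addnS -addn1 PoszD; apply: ray; lia.
have down n : reachable_in (cayley_graph S) (~` F)
    (zexpg h (- k0%:Z)%R) (zexpg h (- (k0 + n)%N%:Z)%R).
  elim: n => [|n IH]; first by rewrite addn0; apply: reachable_refl.
  apply: reachable_trans IH _; apply: (reachable_sym cayS).
  rewrite (_ : (- (k0 + n)%N%:Z)%R = (- (k0 + n.+1)%N%:Z + 1)%R); last by lia.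
  by apply: ray; lia.
have infi (f : nat -> int) x : injective f ->
    (forall n, reachable_in (cayley_graph S) (~` F) x (zexpg h (f n))) ->
    infinite_set [set y | reachable_in (cayley_graph S) (~` F) x y].
  move=> finj fC finC; apply: infinite_nat.
  have := @finite_preimage _ _ _ (fun n => zexpg h (f n)) _ finC.
  move=> /(_ (fun m n _ _ E => finj _ _ (zexpg_inj cyc E))); apply: sub_finite_set.
  by move=> n _; apply: fC.
have [C [_ uniq]] := ends.2 F (wordball_finite finS _).
have Cp : C = [set y | reachable_in (cayley_graph S) (~` F) (zexpg h k0) y].
  apply: uniq; split; first by exists (zexpg h k0) => //; apply: outB; lia.
  by apply: (infi (fun n => Posz (k0 + n))) => // m n; lia.
have Cn : C = [set y | reachable_in (cayley_graph S) (~` F) (zexpg h (- k0%:Z)%R) y].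
  apply: uniq; split; first by exists (zexpg h (- k0%:Z)%R) => //; apply: outB; lia.
  by apply: (infi (fun n => (- (k0 + n)%N%:Z)%R)) => // m n; lia.
have : C (zexpg h (- k0%:Z)%R) by rewrite Cn; apply: reachable_refl.
rewrite Cp => /sign; have := eh k0; have := eh (- k0%:Z)%R; lia.
Qed.

End OneEndedGroups.

(** * Scales with comparable volumes and connected annuli *)

Section GroupScales.
Variables (Gamma : groupType) (S : set Gamma).
Hypotheses (finS : finite_set S) (genS : generates S).
Hypothesis ends : one_ended (cayley_graph S).
Hypothesis growth : polynomial_growth S.
Local Notation len := (wordlen genS).

Let len0 := @wordlen0 _ _ genS.
Let len1 := @wordlen1 _ _ genS.
Let lenV := @wordlenV _ _ genS.
Let lenM := @wordlenM _ _ genS.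
Let len_split := @wordlen_split _ _ genS.
Let mem_ball := mem_wball finS genS.

Lemma wball_mono m n : m <= n -> #|` wball S m| <= #|` wball S n|.
Proof.
move=> mn; apply: fsubset_leq_card; apply/fsubsetP => g; rewrite !mem_ball.
by move=> /leq_trans; apply.
Qed.

Lemma wball_gt0 n : 0 < #|` wball S n|.
Proof. by rewrite cardfs_gt0; apply/fset0Pn; exists 1%g; rewrite mem_ball len1. Qed.

Lemma wball_poly : exists C d, forall n, 0 < n -> #|` wball S n| <= C * n ^ d.
Proof.
by have [C [d Cd]] := growth; exists C, d => n /Cd/geq_card_fset_set.
Qed.

Lemma wball_tripod n : 5 <= n -> 16 * #|` wball S n| <= #|` wball S (12 * n)|.
Proof.
move=> n5; apply: (tripod_growth len1 lenV lenM mem_ball n5).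
apply: contrapT => ntri; have w0 : 0 < 11 * n + 5 by lia.
apply: (one_ended_not_cyclic finS ends).
exact: (not_tripod_cyclic len0 len1 lenV lenM len_split
  (wordlen_unbounded finS genS ends) w0 ntri).
Qed.

Lemma group_scales : exists N, forall t, exists delta m c,
  [/\ t <= delta, 0 < delta, 4 * delta < m <= c, 
      #|` wball S (4 * c)| <= N * #|` wball S delta| &
      forall x y, len x = m -> len y = m ->
        reachable_in (cayley_graph S) [set z | 4 * delta < len z <= c] x y].
Proof.
(* Three uses of [wball_tripod] give the factor [16 ^ 3 = 4096], which exceeds
   [2 * 12 ^ 3 = 3456]. *)
have [Q QE] : exists Q, Q = 12 * 12 * 12 by eexists.
pose w k := #|` wball S (Q ^ k)|.
have [C [d poly]] := wball_poly.
have Q2 : 2 <= Q by rewrite QE.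
have Q0 : 0 < Q by rewrite QE.
have w0 k : 0 < w k by apply: wball_gt0.
have wpoly k : w k <= C * Q ^ (d * k).
  by rewrite mulnC expnM mulnC expnAC; apply: poly; rewrite expn_gt0 Q0.
have super : exists k0, forall k, k0 <= k -> 2 * Q * w k <= w k.+1.
  exists 1 => k k1; rewrite /w expnS; set n := Q ^ k.
  have n5 : 5 <= n.
    rewrite /n -(prednK k1) expnS; apply: (@leq_trans (Q * 1)); first by rewrite QE.
    by rewrite leq_mul2l expn_gt0 Q0 orbT.
  have := wball_tripod n5; have := @wball_tripod (12 * n); have := @wball_tripod (12 * (12 * n)).
  rewrite QE -!mulnA; lia.
have [I IP] := growth_scale Q2 w0 wpoly super.
exists (Q ^ (d.+1 * (I + 2))) => t; have [j [i [tj iI wN wAC]]] := IP t.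
set q := Q ^ (j + 1 + i).
have qE : q = Q ^ (1 + i) * Q ^ j by rewrite /q -expnD; congr (_ ^ _); lia.
have q_ge : 10 * Q ^ j <= q.
  apply: (@leq_trans (Q * Q ^ j)); first by rewrite leq_mul2r QE orbT.
  by rewrite qE expnD expn1 -mulnA leq_mul2l leq_pmull ?orbT // expn_gt0 Q0.
have d0 : 0 < Q ^ j by rewrite expn_gt0 Q0.
have Qq : Q ^ (j + 2 + i) = Q * q by rewrite /q -expnS; congr (_ ^ _); lia.
(* The radii [2 * q] and [9 * q] are those of [annulus_reach]; [4 * (9 * q)] is below [Q * q], where
   [w] is controlled. *)
exists (Q ^ j), (2 * q), (9 * q); split=> //.
- by apply: leq_trans tj _; apply: ltnW; apply: ltn_expl.
- by lia.
- by apply: leq_trans wN; apply: wball_mono; rewrite Qq QE; lia.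
move=> x y xm ym; apply: (annulus_reach len0 len1 lenV lenM len_split mem_ball
  (cayley_dist genS) (ball := wball S)) => //; first by lia.
(* After rounding radii up to powers of [Q], the count required by [annulus_reach] is the last
   inequality of [growth_scale] times [Q ^ j]. *)
have b6 : #|` wball S (6 * q)| <= w (j + 2 + i).
  by apply: wball_mono; rewrite Qq QE; lia.
have b8 : #|` wball S (2 * (4 * Q ^ j))| <= w (j + 1).
  by apply: wball_mono; rewrite addn1 expnS QE; lia.
apply: leq_ltn_trans (_ : w (j + 2 + i) * (7 * q) * w (j + 1) < _).
  by rewrite leq_mul // leq_mul //; lia.
rewrite -/(w (j + 1 + i)) qE.
have -> : w (j + 2 + i) * (7 * (Q ^ (1 + i) * Q ^ j)) * w (j + 1) =
  7 * Q ^ (1 + i) * w (j + 2 + i) * w (j + 1) * Q ^ j by nia.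
apply: leq_ltn_trans (_ : 4 * w (j + 1 + i) ^ 2 * Q ^ j < _).
  by rewrite leq_mul2r wAC orbT.
rewrite mulnAC mulnC ltn_pmul2l ?expn_gt0 ?w0 //.
Qed.

End GroupScales.

(** * Borel sets of finite subsets *)

Section SigmaPredicates.
Variables (T : Type) (M : set (set T)).
Local Notation sigma P := (<<s M>> [set x | P x]).
Implicit Types P R : T -> Prop.

Lemma sigma_not P : sigma P -> <<s M>> [set x | ~ P x].
Proof. by move=> MP; rewrite -[X in <<s M>> X]setTD; apply: sigma_algebraCD. Qed.

Lemma sigma_ex_nat (P : nat -> T -> Prop) :
  (forall n, sigma (P n)) -> <<s M>> [set x | exists n, P n x].
Proof.
move=> MP; have -> : [set x | exists n, P n x] = \bigcup_n [set x | P n x].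
  by apply/seteqP; split=> [x [n nx]|x [n _ nx]]; exists n.
exact: sigma_algebra_bigcup.
Qed.

Lemma sigma_ex (I : Type) (e : nat -> I) (P : I -> T -> Prop) :
  (forall i, exists n, e n = i) ->
  (forall i, sigma (P i)) -> <<s M>> [set x | exists i, P i x].
Proof.
move=> esurj MP; have -> : [set x | exists i, P i x] = [set x | exists n, P (e n) x].
  apply/seteqP; split=> x [i ix]; last by exists (e i).
  by have [n ne] := esurj i; exists n; rewrite ne.
by apply: sigma_ex_nat => n; apply: MP.
Qed.

Lemma sigma_const (p : Prop) : <<s M>> [set x | p].
Proof.
have [pT|pF] := pselect p; last first.
  suff -> : [set x : T | p] = set0 by apply: sigma_algebra0.
  by apply/seteqP; split.
have -> : [set x : T | p] = ~` set0 by rewrite setC0; apply/seteqP; split.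
by rewrite -[X in <<s M>> X]setTD; apply: sigma_algebraCD; apply: sigma_algebra0.
Qed.

Lemma sigma_ext P R : (forall x, P x <-> R x) -> sigma P -> sigma R.
Proof.
move=> PR; have -> // : [set x | P x] = [set x | R x].
by apply/seteqP; split=> x /PR.
Qed.

Lemma sigma_or P R : sigma P -> sigma R -> <<s M>> [set x | P x \/ R x].
Proof.
move=> MP MR; apply: (@sigma_ext (fun x => exists n : nat, if n is 0 then P x else R x)).
  move=> x; split=> [[[|n]]|[]]; [by left|by right|by exists 0%N|by exists 1%N].
by apply: sigma_ex_nat => -[|n].
Qed.

Lemma sigma_and P R : sigma P -> sigma R -> <<s M>> [set x | P x /\ R x].
Proof.
move=> MP MR; apply: (@sigma_ext (fun x => ~ (~ P x \/ ~ R x))).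
  by move=> x; rewrite -not_andE; split=> [/contrapT|? []].
by apply: sigma_not; apply: sigma_or; apply: sigma_not.
Qed.

Lemma sigma_imply P R : sigma P -> sigma R -> <<s M>> [set x | P x -> R x].
Proof.
move=> MP MR; apply: (@sigma_ext (fun x => ~ P x \/ R x)).
  by move=> x; split=> [[]//|PR]; have [/PR|] := pselect (P x); [right|left].
by apply: sigma_or => //; apply: sigma_not.
Qed.

Lemma sigma_iff P R : sigma P -> sigma R -> <<s M>> [set x | P x <-> R x].
Proof. by move=> MP MR; apply: sigma_and; apply: sigma_imply. Qed.

Lemma sigma_all (I : Type) (e : nat -> I) (P : I -> T -> Prop) :
  (forall i, exists n, e n = i) ->
  (forall i, sigma (P i)) -> <<s M>> [set x | forall i, P i x].
Proof.
move=> esurj MP; apply: (@sigma_ext (fun x => ~ exists i, ~ P i x)).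
  by move=> x; split=> [/forallNP h i|h [i]]; [apply: contrapT|apply].
by apply: sigma_not; apply: (sigma_ex esurj) => i; apply: sigma_not.
Qed.

Lemma sigma_all_nat (P : nat -> T -> Prop) :
  (forall n, sigma (P n)) -> <<s M>> [set x | forall n, P n x].
Proof. by apply: (@sigma_all nat id) => n; exists n. Qed.

End SigmaPredicates.

Section FiniteSubsets.
Variable X : topologicalType.

Lemma borelI (A B : set X) : borel A -> borel B -> borel (A `&` B).
Proof. by move=> bA bB; apply: sigma_and. Qed.

(** Lets quantifiers over the points of a finite set be replaced by quantifiers over countably many
    indices. *)
Definition separating (U : nat -> set X) := (forall n, open (U n)) /\
  forall x (F : set X), finite_set F -> ~ F x ->
    exists n, U n x /\ forall y, F y -> ~ U n y.

Definition hits (B : set X) : set {fset X} := [set K | [set` K] `&` B !=set0].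

Variable U : nat -> set X.
Hypothesis sepU : separating U.

Lemma isolate (K : {fset X}) x : exists n, U n x /\ forall y, y \in K -> U n y -> y = x.
Proof.
have finF : finite_set ([set` K] `\ x).
  by apply: (@sub_finite_set _ _ [set` K]) => [y []//|]; apply: finite_fset.
have [|n [nx nK]] := sepU.2 x _ finF; first by case=> _; apply.
exists n; split=> // y yK ny; apply: contrapT => yx.
by apply: (nK y).
Qed.

(* The point of K witnessing that K meets V minus B is isolated by a basic set. *)
Lemma hits_borel (B : set X) : borel B -> fset_borel (hits B).
Proof.
(* Intersecting with every open [V] localizes the claim, which the complement step of the induction
   needs. *)
move=> Bb; suff : forall V, open V -> fset_borel (hits (V `&` B)).
  by move=> /(_ setT openT); rewrite setTI.
move: B Bb; apply: smallest_sub; last first.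
  move=> B oB V oV; apply: sub_sigma_algebra; exists (V `&` B) => //.
  exact: openI.
split.
- move=> V oV; rewrite setI0 (_ : hits set0 = set0); first exact: sigma_algebra0.
  by apply/seteqP; split=> // K [x []].
- move=> B IH V oV; rewrite setTD.
  apply: (@sigma_ext _ _ (fun K => exists n, hits (U n `&` V) K /\
    ~ hits (U n `&` V `&` B) K)).
    move=> K; split=> [[n [[x [Kx [nx Vx]]] nB]]|[x [Kx [Vx Bx]]]].
      by exists x; split=> //; split=> // Bx; apply: nB; exists x.
    have [n [nx iso]] := isolate K x; exists n; split; first by exists x.
    by move=> [y [Ky [[ny _] By]]]; apply: Bx; rewrite -(iso y).
  have oUV n : open (U n `&` V) by apply: openI => //; apply: sepU.1.
  apply: sigma_ex_nat => n; apply: sigma_and.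
    by apply: sub_sigma_algebra; exists (U n `&` V).
  by apply: sigma_not; apply: IH.
- move=> B IH V oV.
  apply: (@sigma_ext _ _ (fun K => exists n, hits (V `&` B n) K)).
    by move=> K; split=> [[n [x [Kx [Vx nx]]]]|[x [Kx [Vx [n _ nx]]]]];
      [exists x; split=> //; split=> //; exists n|exists n, x].
  by apply: sigma_ex_nat => n; apply: IH.
Qed.

Variables (Gamma : groupType) (a : Gamma -> X -> X) (e : nat -> Gamma).
Hypotheses (borel_a : borel_action a) (e_surj : forall g, exists n, e n = g).

(** Finite sets are compared through the sets [U l] that they hit. The point [p] is replaced by
    indices: an isolating [n] makes the formula true, and conversely an isolating [m] leaves a
    single witness in [D n m]. *)
Lemma pattern_borel (P : set Gamma) (B : set X) : finite_set P -> P 1%g -> borel B ->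
  fset_borel [set K : {fset X} | exists2 p, B p & [set` K] = [set a g p | g in P]].
Proof.
move=> finP P1 Bb; have [[a1 _] a_pre] := borel_a.
have bU n : borel (U n) by apply: sub_sigma_algebra; apply: sepU.1.
pose D n m := U n `&` U m `&` B.
apply: (@sigma_ext _ _ (fun K => exists n, hits (U n `&` B) K /\
  forall m, hits (D n m) K -> forall l,
    (hits (U l) K <-> exists g, P g /\ hits (D n m `&` a g @^-1` U l) K))); last first.
  have hD n m : borel (D n m) by apply: borelI => //; apply: borelI.
  apply: sigma_ex_nat => n; apply: sigma_and.
    by apply: hits_borel; apply: borelI.
  apply: sigma_all_nat => m; apply: sigma_imply; first exact: hits_borel.
  apply: sigma_all_nat => l; apply: sigma_iff; first exact: hits_borel.
  apply: (sigma_ex e_surj) => g; apply: sigma_and; first exact: sigma_const.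
  by apply: hits_borel; apply: borelI => //; apply: a_pre.
move=> K; split=> [[n [[p [Kp [np Bp]]] H]]|[p Bp KE]].
  exists p => //; have [m [mp iso]] := isolate K p.
  have {}H l : hits (U l) K <-> exists g, P g /\ U l (a g p).
    rewrite (H m); last by exists p.
    split=> [[g [Pg [y [Ky [[[_ my] _] gy]]]]]|[g [Pg gp]]].
      by exists g; split=> //; rewrite -(iso y).
    by exists g; split=> //; exists p.
  apply/seteqP; split=> [x Kx|_ [g Pg <-]]; apply: contrapT => nx.
    have finPp : finite_set [set a g p | g in P] by apply: finite_image.
    have [l [lx nl]] := sepU.2 _ _ finPp nx.
    have /H[g [Pg gp]] : hits (U l) K by exists x.
    by apply: (nl (a g p)) => //; exists g.
  have [l [lx nl]] := sepU.2 _ _ (finite_fset K) nx.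
  have /H[y [Ky ly]] : exists g, P g /\ U l (a g p) by exists g.
  exact: (nl y).
have Kp : p \in K.
  by have : [set` K] p by rewrite KE; exists 1%g.
have [n [np iso]] := isolate K p; exists n; split; first by exists p.
move=> m [y [Ky [[ny my] By]]] l; have yp := iso y Ky ny; rewrite {}yp in my {Ky ny By}.
split=> [[x [Kx lx]]|[g [Pg [z [Kz [[[nz _] _] gz]]]]]].
  have : [set` K] x by []; rewrite KE => -[g Pg gp].
  by exists g; split=> //; exists p; split=> //; split=> //; rewrite /preimage /= gp.
rewrite (iso z Kz nz) in gz; exists (a g p); split=> //.
by rewrite KE; exists g.
Qed.

End FiniteSubsets.

(** * Countable separating families in Polish spaces *)

Section PolishBasis.
Local Open Scope ring_scope.
Import GRing.Theory Num.Theory Order.TTheory.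

Lemma polish_separating (R : realType) (X : topologicalType) :
  polish R X -> exists U : nat -> set X, separating U.
Proof.
move=> [[D cD dD] [d [d0 deq dsym dtri dnbhs _]]].
have /countable_injP[f finj] := cD.
pose r n : R := n.+1%:R^-1.
have r0 n : 0 < r n by rewrite invr_gt0.
pose ball q e := [set y | d q y < e].
have ballO q e : open (ball q e).
  rewrite openE => y /= qy; apply/dnbhs; exists (e - d q y); first by rewrite subr_gt0.
  by move=> z /= yz; rewrite /ball /= (le_lt_trans (dtri q y z)) // -ltrBrDl.
(* As [f] is injective on [D], the union has at most one term: a ball of radius [r n] around a dense
   point. *)
pose U k := if choice.unpickle k is Some (i, n) then
  \bigcup_(q in [set q | D q /\ f q = i]) ball q (r n) else set0.
have dpos x y : x <> y -> 0 < d x y.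
  move=> xy; rewrite lt_neqAle; apply/andP; split.
    by apply/eqP => /esym/deq.
  have := dtri x y x; rewrite d0 (dsym y x) -mulr2n pmulrn_lge0 //.
exists U; split=> [k|x F /finite_seqP[s ->] nx].
  rewrite /U; case: (choice.unpickle k) => [[i n]|]; last exact: open0.
  by apply: bigcup_open => q _; apply: ballO.
have [e e0 es] : exists2 e, 0 < e & forall y, y \in s -> e <= d x y.
  elim: s nx => [|y s IH] nx; first by exists 1.
  have [|e e0 es] := IH; first by move=> xs; apply: nx; rewrite /= inE (xs : x \in s) orbT.
  have xy : 0 < d x y by apply: dpos => xy; apply: nx; rewrite /= xy mem_head.
  exists (Order.min e (d x y)); first by rewrite lt_min e0.
  by move=> z; rewrite inE ge_min => /orP[/eqP->|/es->//]; rewrite lexx orbT.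
have [n nE] : exists n, r n + r n <= e.
  have [n] := ltr_add_invr (divr_gt0 e0 (ltr0n R 2)); rewrite add0r => /ltW re.
  by exists n; rewrite (splitr e) lerD.
have [q [qx Dq]] : ball x (r n) `&` D !=set0.
  by apply: dD; [exists x; rewrite /ball /= d0|].
exists (choice.pickle (f q, n)); rewrite /U choice.pickleK; split.
  by exists q => //; rewrite /ball /= dsym.
move=> y /= ys [q' [Dq' /finj E] qy].
have {}E : q' = q by apply: E; rewrite inE.
rewrite {}E in qy; have := es y ys; apply/negP; rewrite -ltNge.
by apply: lt_le_trans nE; apply: le_lt_trans (dtri x q y) (ltrD qx qy).
Qed.
End PolishBasis.

(** * Borel markers *)

Section Markers.
Variables (X : topologicalType) (U : nat -> set X).
Hypothesis sepU : separating U.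
Variables (Gamma : groupType) (S : set Gamma).
Hypotheses (finS : finite_set S) (genS : generates S).
Variable a : Gamma -> X -> X.
Hypotheses (borel_a : borel_action a) (free_a : free_action a).
Implicit Types (x y : X) (Y : set X).

Let a1 x : a 1%g x = x := borel_a.1.1 x.
Let aM g h x : a (g * h)%g x = a g (a h x) := borel_a.1.2 g h x.

Lemma actK g x : a g^-1%g (a g x) = x.
Proof. by rewrite -aM mulVg a1. Qed.

Lemma act_inj g h x : a g x = a h x -> g = h.
Proof.
move=> gh; apply/esym/divg1_eq; apply: (free_a (x := a g x)).
by rewrite aM actK.
Qed.

Lemma group_enum : exists e : nat -> Gamma, forall g, exists n, e n = g.
Proof.
exists (fun k => if choice.unpickle k is Some (n, i) then nth 1%g (wball S n) i else 1%g) => g.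
exists (choice.pickle (wordlen genS g, index g (wball S (wordlen genS g)))).
by rewrite choice.pickleK nth_index // mem_wball.
Qed.

Lemma borel_act g Y : borel Y -> borel [set x | Y (a g x)].
Proof. exact: borel_a.2. Qed.

Lemma borel_exg (P : Gamma -> X -> Prop) :
  (forall g, borel [set x | P g x]) -> borel [set x | exists g, P g x].
Proof. by have [e es] := group_enum; apply: sigma_ex es. Qed.

Lemma borel_allg (P : Gamma -> X -> Prop) :
  (forall g, borel [set x | P g x]) -> borel [set x | forall g, P g x].
Proof. by have [e es] := group_enum; apply: sigma_all es. Qed.

(** Countably many sets, each separated along orbits; by freeness they cover the space
    ([slice_cover]). *)
Definition slice r k := [set x | U k x /\
  forall g, wordball S r g -> g <> 1%g -> ~ U k (a g x)].

(** Greedy construction of a maximal separated subset of [Y]: slices are treated in turn, and points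
    of one slice never conflict. *)
Fixpoint sepstage r Y k : set X :=
  if k is j.+1 then sepstage r Y j `|`
    [set x | (slice r j x /\ Y x) /\ forall g, wordball S r g -> ~ sepstage r Y j (a g x)]
  else set0.

Definition maxsep r Y := [set x | exists k, sepstage r Y k x].

Lemma slice_borel r k : borel (slice r k).
Proof.
have bU : borel (U k) by apply: sub_sigma_algebra; apply: sepU.1.
apply: sigma_and => //; apply: borel_allg => g.
apply: sigma_imply; first exact: sigma_const.
apply: sigma_imply; first exact: sigma_const.
by apply: sigma_not; apply: borel_act.
Qed.

Lemma maxsep_borel r Y : borel Y -> borel (maxsep r Y).
Proof.
move=> bY; apply: sigma_ex_nat; elim=> [|k IH]; first exact: sigma_algebra0.
apply: sigma_or => //; apply: sigma_and.
  by apply: sigma_and => //; apply: slice_borel.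
apply: borel_allg => g; apply: sigma_imply; first exact: sigma_const.
by apply: sigma_not; apply: borel_act.
Qed.

Lemma sepstage_mono r Y i j : i <= j -> sepstage r Y i `<=` sepstage r Y j.
Proof.
move=> /subnK <-; elim: (j - i) => [//|n IH] x /IH ix.
by rewrite addSn; left.
Qed.

Lemma maxsep_sub r Y : maxsep r Y `<=` Y.
Proof. by move=> x [k]; elim: k => [//|k IH] [/IH//|[[]]]. Qed.

Lemma slice_cover r x : exists k, slice r k x.
Proof.
pose F := [set a g x | g in wordball S r `\ 1%g].
have finF : finite_set F.
  by apply: finite_image; apply: sub_finite_set (wordball_finite finS r); apply: subDsetl.
have [|k [kx kF]] := sepU.2 x F finF; first by case=> g [_ g1] /free_a.
by exists k; split=> // g rg g1; apply: kF; exists g.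
Qed.

Lemma maxsep_sep r Y x g : maxsep r Y x -> maxsep r Y (a g x) -> wordball S r g -> g = 1%g.
Proof.
have first_stage y : maxsep r Y y -> exists k, [/\ slice r k y, sepstage r Y k.+1 y &
    forall h, wordball S r h -> ~ sepstage r Y k (a h y)].
  move=> [k]; elim: k => [//|k IH] /= [/IH//|yk].
  by exists k; split; [case: yk => -[]|right|case: yk].
move=> /first_stage[i [si xi ni]] /first_stage[j [sj yj nj]] rg.
case: (ltngtP i j) => ij.
- exfalso; apply: (nj g^-1%g); first exact: wordballV.
  by rewrite actK; apply: sepstage_mono xi.
- by exfalso; apply: (ni g) => //; apply: sepstage_mono yj.
- apply: contrapT => g1; subst j; case: si => _ /(_ g rg g1); apply.
  by case: sj.
Qed.

Lemma maxsep_max r Y x : Y x -> exists2 g, wordball S r g & maxsep r Y (a g x).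
Proof.
move=> Yx; have [k kx] := slice_cover r x.
have [[g rg gx]|nx] := pselect (exists2 g, wordball S r g & sepstage r Y k (a g x)).
  by exists g => //; exists k.
exists 1%g; first by apply/(wordballE genS); rewrite wordlen1.
by exists k.+1; rewrite a1; right; split=> // g rg gx; apply: nx; exists g.
Qed.

Section Scale.
Variables delta c : nat.

(** Each round takes a maximal separated family among the points not yet within [2 * delta] of
    earlier markers. *)
Fixpoint covered i : set X :=
  if i is j.+1 then covered j `|`
    [set x | exists2 g, wordball S (2 * delta) g & maxsep (3 * c) (~` covered j) (a g x)]
  else set0.

Definition marker i := maxsep (3 * c) (~` covered i).

Lemma covered_borel i : borel (covered i).
Proof.
elim: i => [|i IH]; first exact: sigma_algebra0.
apply: sigma_or => //; apply: (@sigma_ext _ _ (fun x => exists g,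
  wordball S (2 * delta) g /\ maxsep (3 * c) (~` covered i) (a g x))).
  by move=> x; split=> [[g []]|[g]]; exists g.
apply: borel_exg => g; apply: sigma_and; first exact: sigma_const.
by apply: borel_act; apply: maxsep_borel; apply: sigma_not.
Qed.

Lemma marker_borel i : borel (marker i).
Proof. by apply: maxsep_borel; apply: sigma_not; apply: covered_borel. Qed.

(* If x were never covered, x and the markers near it chosen in the N rounds
   would be N + 1 points at distances more than 2 delta from each other. *)
Lemma marker_covers N x : delta <= c ->
  #|` wball S (4 * c)| <= N * #|` wball S delta| ->
  exists i, i < N /\ exists2 g, wordball S (2 * delta) g & marker i (a g x).
Proof.
move=> dc count; apply: contrapT => none.
have ncov i : i <= N -> ~ covered i x.
  elim: i => [_ []|i IH iN [/(IH (ltnW iN))//|cov]].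
  by apply: none; exists i.
have cov_mono i j : i <= j -> covered i `<=` covered j.
  by move=> /subnK <-; elim: (j - i) => [//|n IH] y /IH iy; rewrite addSn; left.
(* For [i < N], maximality gives a marker of round [i] within [3 * c] of [x]; the index [N] stands
   for [x] itself. *)
have /choice[f fP] : forall i : 'I_N.+1, exists g, [/\ wordball S (3 * c) g,
    ~ covered i (a g x) & i < N -> marker i (a g x)].
  move=> i; have [iN|Ni] := ltnP i N; last first.
    exists 1%g; rewrite a1; split=> //; first by apply/(wordballE genS); rewrite wordlen1.
    by apply: ncov; rewrite -ltnS.
  have [g rg gx] := @maxsep_max (3 * c) (~` covered i) x (ncov i (ltnW iN)).
  by exists g; split=> //; apply: maxsep_sub gx.
have sep1 (i j : 'I_N.+1) : i < j -> 2 * delta < dist (wordlen genS) (f i) (f j).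
  move=> ij; rewrite ltnNge; apply/negP => dij.
  have [_ _ mi] := fP i; have [_ nj _] := fP j; apply: nj.
  apply: (cov_mono i.+1) => //; right; exists (f i * (f j)^-1)%g.
    by apply/(wordballE genS); rewrite -wordlenV invgM invgK.
  rewrite aM actK; apply: mi.
  by rewrite -ltnS (leq_ltn_trans ij).
have near i : dist (wordlen genS) 1%g (f i) <= 3 * c.
  by rewrite dist1; apply/wordballE; case: (fP i).
have sep i j : i != j -> 2 * delta < dist (wordlen genS) (f i) (f j).
  by rewrite neq_ltn => /orP[/sep1//|/sep1]; rewrite (dist_sym (@wordlenV _ _ genS)).
(* The [N + 1] balls of radius [delta] fit into radius [3 * c + delta], at most [4 * c], against
   [count]. *)
have := packing (@wordlenV _ _ genS) (@wordlenM _ _ genS) (mem_wball finS genS) near sep.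
rewrite card_ord; apply/negP; rewrite -ltnNge.
apply: (@leq_ltn_trans (N * #|` wball S delta|)).
  by apply: leq_trans count; apply: (wball_mono finS genS); lia.
by rewrite ltn_pmul2r // (wball_gt0 finS genS).
Qed.

End Scale.
End Markers.

(** * Borel sets defined along orbits *)

Section BorelOrbitRelations.
Variables (X : topologicalType) (Gamma : groupType) (S : set Gamma).
Hypotheses (finS : finite_set S) (genS : generates S).
Variable a : Gamma -> X -> X.
Hypotheses (borel_a : borel_action a) (free_a : free_action a).
Local Notation G := (schreier_graph S a).

Let a1 x : a 1%g x = x := borel_a.1.1 x.
Let aM g h x : a (g * h)%g x = a g (a h x) := borel_a.1.2 g h x.

Lemma gball_act r g h x :
  gball G r [set a g x] (a h x) <-> wordball S r (h * g^-1)%g.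
Proof.
rewrite (gball_schreier S r _ _ borel_a.1); split=> [[k rk]|rhg].
  by rewrite -aM => /(act_inj borel_a free_a) ->; rewrite mulgK.
by exists (h * g^-1)%g; rewrite // -aM mulgVK.
Qed.

Lemma schreier_act g h x : G (a g x) (a h x) <-> cayley_graph S g h.
Proof.
have inj := @act_inj _ _ _ borel_a free_a.
split=> [[neq [s Ss H]]|[neq [s Ss H]]].
  split; first by move=> gh; apply: neq; rewrite gh.
  by exists s => //; case: H => [|]; rewrite -aM => /inj; [left|right].
split; first by move=> /inj.
by exists s => //; case: H => ->; rewrite aM; [left|right].
Qed.

Lemma gball_orbit r x y : gball G r [set x] y -> exists g, y = a g x.
Proof. by move=> /(gball_schreier S r _ _ borel_a.1)[g _ ->]; exists g. Qed.

(** Relations on the orbit of [x] are coded by pairs of group elements, so quantifiers over points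
    of the orbit become countable. *)
Definition orbit_borel (R : X -> X -> X -> Prop) :=
  forall g h, borel [set x | R x (a g x) (a h x)].

(** The closure is a union over path lengths, and by [orb] all intermediate points stay in the
    orbit. *)
Lemma clos_orbit_borel (R : X -> X -> X -> Prop) : orbit_borel R ->
  (forall x u v, R x u v -> exists g, v = a g u) ->
  orbit_borel (fun x => clos_refl_trans X (R x)).
Proof.
move=> bR orb g h.
pose steps x := fix steps k u v := if k is j.+1 then
  exists2 w, steps j u w & R x w v else u = v.
apply: (@sigma_ext _ _ (fun x => exists k, steps x k (a g x) (a h x))).
  move=> x; split=> [[k]|].
    elim: k (a h x) => [v <-|k IH v [w /IH gw wv]]; first exact: rt_refl.
    by apply: rt_trans gw _; apply: rt_step.
  elim/clos_refl_trans_ind_left => [|u v _ [k gk] uv]; first by exists 0%N.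
  by exists k.+1, u.
apply: sigma_ex_nat => k; elim: k h => [|k IH] h /=.
  apply: (@sigma_ext _ _ (fun=> g = h)); last exact: sigma_const.
  by move=> x; split=> [->//|/(act_inj borel_a free_a)].
apply: (@sigma_ext _ _ (fun x => exists l, steps x k (a g x) (a l x) /\ R x (a l x) (a h x))).
  move=> x; split=> [[l [gl lh]]|[w gw wh]]; first by exists (a l x).
  suff [l wl] : exists l, w = a l x by exists l; rewrite -wl.
  elim: k w gw {wh IH} => [w <-|k IH w [v /IH[l ->] /orb[l' ->]]]; first by exists g.
  by exists (l' * l)%g; rewrite aM.
apply: (borel_exg finS genS) => l; apply: sigma_and; [exact: IH|exact: bR].
Qed.

Variables (Q : nat -> set X) (beta m c : nat -> nat).
Hypothesis Q_borel : forall n, borel (Q n).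

Lemma link_borel n : orbit_borel (fun=> link G Q c n).
Proof.
move=> g h.
apply: (@sigma_ext _ _ (fun x => exists j k, ((j < n)%N /\ Q j (a k x)) /\
  (gball G (c j) [set a k x] (a g x) /\ gball G (c j) [set a k x] (a h x)))).
  move=> x; split=> [[j [k [[jn Qk] kgh]]]|[j [q [jn Qq] [qg qh]]]].
    by exists j, (a k x).
  have [k kE] := gball_orbit (gball_sym (@schreier_sym _ _ _ _) qg).
  by exists j, (k * g)%g; rewrite aM -kE.
apply: sigma_ex_nat => j; apply: (borel_exg finS genS) => k; apply: sigma_and.
  by apply: sigma_and; [exact: sigma_const|exact: (borel_act borel_a)].
by apply: sigma_and; apply: (sigma_ext (fun x => iff_sym (gball_act _ _ _ x)));
  apply: sigma_const.
Qed.

Lemma ball_borel r g h : borel [set x | gball G r [set a g x] (a h x)].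
Proof.
by apply: (sigma_ext (fun x => iff_sym (gball_act _ _ _ x))); apply: sigma_const.
Qed.

Lemma core_borel n g : borel [set x | core G Q beta c n x (a g x)].
Proof.
apply: (@sigma_ext _ _ (fun x => exists k, gball G (beta n) [set a 1%g x] (a k x) /\
  clos_refl_trans X (link G Q c n) (a k x) (a g x))).
  move=> x; rewrite a1; split=> [[k [xk kg]]|[y xy yg]]; first by exists (a k x).
  by have [k kE] := gball_orbit xy; exists k; rewrite -kE.
apply: (borel_exg finS genS) => k; apply: sigma_and; first exact: ball_borel.
apply: (clos_orbit_borel (@link_borel n)) => _ u v [j [q _ [qu qv]]].
have [k' kE] := gball_orbit (gball_sym (@schreier_sym _ _ _ _) qu).
by have [l ->] := gball_orbit qv; exists (l * k')%g; rewrite aM -kE.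
Qed.

Lemma hull_borel n g : borel [set x | hull G Q beta m c n x (a g x)].
Proof.
have ballx r h : borel [set x | gball G r [set x] (a h x)].
  by apply: (sigma_ext _ (@ball_borel r 1%g h)) => x; rewrite a1.
have ring h : borel [set x | (gball G (m n) [set x] `\` core G Q beta c n x) (a h x)].
  exact: (sigma_and (ballx (m n) h) (sigma_not (core_borel n h))).
apply: (@sigma_ext _ _ (fun x => gball G (m n) [set x] (a g x) /\
  forall k, sphere G (m n) x (a k x) ->
    ~ reachable_in G (gball G (m n) [set x] `\` core G Q beta c n x) (a g x) (a k x))).
  move=> x; split=> -[xg H]; split=> //; last by move=> k; apply: H.
  by move=> z Sz; have [k kE] := gball_orbit Sz.1; subst z; apply: (H k Sz).
apply: sigma_and; first exact: ballx.
apply: (borel_allg finS genS) => k; apply: sigma_imply.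
  apply: sigma_and; first exact: ballx.
  apply: sigma_all_nat => j; apply: sigma_imply; first exact: sigma_const.
  by apply: sigma_not; apply: ballx.
apply: sigma_not; apply: (@clos_orbit_borel (fun x u v =>
  [/\ (gball G (m n) [set x] `\` core G Q beta c n x) u,
      (gball G (m n) [set x] `\` core G Q beta c n x) v & G u v])).
  move=> u v; apply: (@sigma_ext _ _ (fun x =>
    ((gball G (m n) [set x] `\` core G Q beta c n x) (a u x) /\
     (gball G (m n) [set x] `\` core G Q beta c n x) (a v x)) /\ cayley_graph S u v)).
    by move=> x; rewrite -(schreier_act u v x); split=> [[[]]|[]].
  apply: sigma_and; last exact: sigma_const.
  by apply: sigma_and; apply: ring.
by move=> x u v [_ _ /(schreier_step borel_a.1)[s _ ->]]; exists s.
Qed.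

Hypothesis Qcenter : forall n p, Q n p -> hull G Q beta m c n p p.

Lemma hull_finite n p : finite_set (hull G Q beta m c n p).
Proof.
apply: (@sub_finite_set _ _ [set a g p | g in wordball S (m n)]).
  by move=> y [/(gball_schreier S _ _ _ borel_a.1)[g mg ->] _]; exists g.
by apply: finite_image; apply: wordball_finite.
Qed.

Variable U : nat -> set X.
Hypothesis sepU : separating U.

(* The hull of p is one of countably many finite patterns around p. *)
Lemma hulls_borel :
  fset_borel [set K : {fset X} | exists n p, Q n p /\ [set` K] = hull G Q beta m c n p].
Proof.
have [e e_surj] := group_enum finS genS.
pose pat (s : seq nat) : set Gamma := [set e i | i in [set` s]].
pose base n s := [set p | Q n p /\ forall g, hull G Q beta m c n p (a g p) <-> pat s g].
pose en k : seq nat := odflt [::] (choice.unpickle k).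
have en_surj s : exists k, en k = s.
  by exists (choice.pickle s); rewrite /en choice.pickleK.
apply: (@sigma_ext _ _ (fun K => exists n s, pat s 1%g /\
  exists2 p, base n s p & [set` K] = [set a g p | g in pat s])).
  move=> K; split=> [[n [s [_ [p [Qp ps] KE]]]]|[n [p [Qp KE]]]].
    exists n, p; split=> //; rewrite KE; apply/seteqP; split=> [_ [g /ps pg <-]//|y hy].
    by have [g gE] := gball_orbit hy.1; exists g => //; apply/ps; rewrite -gE.
  have fin : finite_set [set g | hull G Q beta m c n p (a g p)].
    apply: (@finite_preimage _ _ _ (a^~ p)); last exact: hull_finite.
    by move=> g h _ _; apply: (act_inj borel_a free_a).
  have [s sE] : exists s, [set g | hull G Q beta m c n p (a g p)] = pat s.
    move: fin => /finite_seqP[s ->]; have /choice[i iP] := e_surj.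
    exists (map i s); apply/seteqP; split=> [g gs|_ [j /= /mapP[g gs ->] <-]].
      by exists (i g) => //=; apply: map_f.
    by rewrite iP.
  have pats g : hull G Q beta m c n p (a g p) <-> pat s g by rewrite -sE.
  exists n, s; split; first by apply/pats; rewrite a1; apply: Qcenter.
  exists p => //; rewrite KE; apply/seteqP; split=> [y hy|_ [g /pats gp <-]//].
  by have [g gE] := gball_orbit hy.1; exists g => //; apply/pats; rewrite -gE.
apply: sigma_ex_nat => n; apply: (sigma_ex en_surj) => s.
(* [pattern_borel] asks for the identity in the pattern; other patterns are excluded by the first
   conjunct. *)
have [s1|ns1] := pselect (pat s 1%g); last first.
  by apply: (@sigma_ext _ _ (fun=> False)); [split=> // -[]|exact: sigma_const].
apply: sigma_and; first exact: sigma_const.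
apply: (pattern_borel sepU borel_a e_surj) => //.
  by apply: finite_image; apply: finite_seq.
apply: sigma_and; first exact: Q_borel.
apply: (borel_allg finS genS) => g.
by apply: sigma_iff; [exact: hull_borel|exact: sigma_const].
Qed.

End BorelOrbitRelations.

(** * The toast *)

Section ToastConstruction.
Variables (X : topologicalType) (U : nat -> set X).
Hypothesis sepU : separating U.
Variables (Gamma : groupType) (S : set Gamma).
Hypotheses (finS : finite_set S) (genS : generates S).
Hypothesis ends : one_ended (cayley_graph S).
Variable a : Gamma -> X -> X.
Hypotheses (borel_a : borel_action a) (free_a : free_action a).
Local Notation G := (schreier_graph S a).
Local Notation len := (wordlen genS).

Let a1 x : a 1%g x = x := borel_a.1.1 x.
Let aM g h x : a (g * h)%g x = a g (a h x) := borel_a.1.2 g h x.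
Let Gsym := @schreier_sym _ S _ a.

Lemma sphere_act r g p : sphere G r p (a g p) <-> len g = r.
Proof.
have ballE k : gball G k [set p] (a g p) <-> (len g <= k)%N.
  by rewrite -{1}(a1 p) (gball_act S borel_a free_a) invg1 mulg1 (wordballE genS).
split=> [[/ballE gr far]|gr].
  apply/eqP; rewrite eqn_leq gr leqNgt /=; apply/negP => lt.
  by apply: (far _ lt); apply/ballE.
by split=> [|k kr /ballE]; [apply/ballE; rewrite gr|rewrite gr; lia].
Qed.

Lemma sphere_nonempty r p : sphere G r p !=set0.
Proof.
have [g rg] := wordlen_unbounded finS genS ends r.
have [u [w [_ wr _]]] := wordlen_split rg.
by exists (a w p); apply/sphere_act.
Qed.

Lemma annular_act (b m c : nat -> nat) n p :
  (forall x y, len x = m n -> len y = m n -> reachable_in (cayley_graph S)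
    [set z | (b n < len z <= c n)%N] x y) -> annular G b m c n p.
Proof.
move=> ann x y Sx Sy.
have [g gE] := gball_orbit borel_a Sx.1; have [h hE] := gball_orbit borel_a Sy.1.
subst x y; have := ann g h ((sphere_act _ _ _).1 Sx) ((sphere_act _ _ _).1 Sy).
have inR z : (b n < len z <= c n)%N ->
    (gball G (c n) [set p] `\` gball G (b n) [set p]) (a z p).
  have ballE k : gball G k [set p] (a z p) <-> (len z <= k)%N.
    by rewrite -{1}(a1 p) (gball_act S borel_a free_a) invg1 mulg1 (wordballE genS).
  by move=> /andP[bz zc]; split; [apply/ballE|move/ballE; lia].
elim=> [u v [Au Av uv]|u|u v w _ IH1 _ IH2].
- by apply: reachable_step; [exact: inR|exact: inR|apply/(schreier_act S borel_a free_a)].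
- exact: reachable_refl.
- exact: reachable_trans IH1 IH2.
Qed.

(** * Choosing one family of markers on each orbit *)

Section Recurrence.
Variables (N : nat) (delta c : nat -> nat).
Hypothesis delta_n : forall n, (n <= delta n)%N.
Hypothesis delta_c : forall n, (delta n <= c n)%N.
Hypothesis count : forall n,
  (#|` wball S (4 * c n)| <= N * #|` wball S (delta n)|)%N.
Local Notation mark n i := (marker U S a (delta n) (c n) i).

(* Since the scales tend to infinity, recurrence depends only on the orbit of x. *)
Definition recurrent i x := exists k, forall n0, exists n, (n0 <= n)%N /\
  exists g, wordball S (2 * delta n + k) g /\ mark n i (a g x).

Definition colour i x := recurrent i x /\ forall j, (j < i)%N -> ~ recurrent j x.

Definition centers n : set X := [set p | exists i, mark n i p /\ colour i p].

(** The additive constant [k] absorbs the displacement [len g]. *)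
Lemma recurrent_act i g x : recurrent i x -> recurrent i (a g x).
Proof.
move=> [k rec]; exists (k + len g)%N => n0; have [n [nn0 [h [kh hx]]]] := rec n0.
exists n; split=> //; exists (h * g^-1)%g; split; last first.
  by rewrite aM actK.
rewrite addnA; apply: wordballM => //; apply/(wordballE genS).
by rewrite wordlenV.
Qed.

Lemma recurrent_actE i g x : recurrent i (a g x) <-> recurrent i x.
Proof.
split; last exact: recurrent_act.
by move=> /(@recurrent_act _ g^-1%g); rewrite actK.
Qed.

Lemma colour_act i g x : colour i (a g x) <-> colour i x.
Proof.
rewrite /colour recurrent_actE; split=> -[ri nj]; split=> // j ji.
  by rewrite -(recurrent_actE _ g); apply: nj.
by rewrite recurrent_actE; apply: nj.
Qed.

Lemma colour_inj i j x : colour i x -> colour j x -> i = j.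
Proof.
by move=> [ri ni] [rj nj]; case: (ltngtP i j) => // [/nj|/ni].
Qed.

(** If no family were recurrent, the first [N] would all stay away from [x] beyond some scale,
    against [marker_covers] there. *)
Lemma colour_exists x : exists i, colour i x.
Proof.
have [i ri] : exists i, recurrent i x.
  apply: contrapT => /forallNP none.
  have [n0 bound] : exists n0, forall i n, (i < N)%N -> (n0 <= n)%N ->
      ~ exists2 g, wordball S (2 * delta n) g & mark n i (a g x).
    elim: N => [|M [n0 IH]]; first by exists 0%N.
    have [n1 H1] : exists n1, forall n, (n1 <= n)%N ->
        ~ exists2 g, wordball S (2 * delta n) g & mark n M (a g x).
      apply: contrapT => /forallNP H; apply: (none M); exists 0%N => n1.
      have /existsNP[n /not_implyP[nn1 /contrapT[g ng gx]]] := H n1.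
      by exists n; split=> //; exists g; rewrite addn0.
    exists (maxn n0 n1) => i n; rewrite ltnS leq_eqVlt geq_max => /orP[/eqP->|iM] /andP[nn0 nn1].
      exact: H1.
    exact: IH.
  have [i [iN H]] := marker_covers sepU finS genS borel_a free_a x (delta_c n0) (count n0).
  exact: bound H.
have exr : exists i, `[< recurrent i x >] by exists i; apply/asboolP.
case: (ex_minnP exr) => j /asboolP rj jmin; exists j; split=> // l lj rl.
have := jmin l (asboolT rl); lia.
Qed.

(** Colours are constant on orbits, so both centers belong to the same separated family. *)
Lemma centers_sep n p g : centers n p -> centers n (a g p) ->
  wordball S (3 * c n) g -> g = 1%g.
Proof.
move=> [i [mi ci]] [j [mj /colour_act cj]]; rewrite (colour_inj cj ci) in mj.
exact: (maxsep_sep borel_a mi mj).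
Qed.

Lemma centers_cover x y : G x y -> exists n p, [/\ centers n p,
  gball G (3 * delta n) [set p] x & gball G (3 * delta n) [set p] y].
Proof.
move=> xy; have [i ci] := colour_exists x.
(* From scale [k + 1] on, [delta n] absorbs both [k] and the extra step to [y]. *)
have [k rec] := ci.1; have [n [kn [g [ng gx]]]] := rec k.+1.
have gxx : gball G (2 * delta n + k) [set a g x] x.
  by apply: gball_sym => //; apply/(gball_schreier S _ _ _ borel_a.1); exists g.
have := delta_n n => dn.
exists n, (a g x); split.
- by exists i; split=> //; apply/colour_act.
- by apply: gball_le gxx; lia.
- apply: (@gball_le _ _ (2 * delta n + k + 1)); first by lia.
  by apply: gball_trans gxx _; apply/gball1; right.
Qed.

Lemma centers_borel n : borel (centers n).
Proof.
have bm n' i : borel (mark n' i) by apply: (marker_borel sepU finS genS borel_a).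
have br i : borel [set x | recurrent i x].
  apply: sigma_ex_nat => k; apply: sigma_all_nat => n0; apply: sigma_ex_nat => n'.
  apply: sigma_and; first exact: sigma_const.
  apply: (borel_exg finS genS) => g; apply: sigma_and; first exact: sigma_const.
  exact: (borel_act borel_a).
apply: sigma_ex_nat => i; apply: sigma_and; first exact: bm.
apply: sigma_and; first exact: br.
apply: sigma_all_nat => j; apply: sigma_imply; first exact: sigma_const.
by apply: sigma_not; apply: br.
Qed.

End Recurrence.

Hypothesis growth : polynomial_growth S.

Lemma connected_toast_exists : exists T : set {fset X}, connected_toast G T.
Proof.
have [N scales] := group_scales finS genS ends growth.
have /choice[F FP] : forall t, exists s : nat * nat * nat,
    let: (delta, m, c) := s in
  [/\ (t <= delta)%N, (0 < delta)%N, (4 * delta < m <= c)%N,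
      (#|` wball S (4 * c)| <= N * #|` wball S delta|)%N &
      forall x y, len x = m -> len y = m ->
        reachable_in (cayley_graph S) [set z | (4 * delta < len z <= c)%N] x y].
  by move=> t; have [delta [m [c H]]] := scales t; exists (delta, m, c).
(* Each scale is chosen above the total displacement that all earlier scales can cause, which makes
   [t_step] an equality. *)
pose t n := iter n (fun s => (2 * s + 2 * (F s).2)%N) 0%N.
pose delta n := (F (t n)).1.1; pose m n := (F (t n)).1.2; pose c n := (F (t n)).2.
have {}FP n : [/\ (t n <= delta n)%N, (0 < delta n)%N, (4 * delta n < m n <= c n)%N,
    (#|` wball S (4 * c n)| <= N * #|` wball S (delta n)|)%N &
    forall x y, len x = m n -> len y = m n ->
      reachable_in (cayley_graph S) [set z | (4 * delta n < len z <= c n)%N] x y].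
  by have := FP (t n); rewrite /delta /m /c; case: (F (t n)) => [[]].
have t_step n : (2 * t n + 2 * c n <= t n.+1)%N by [].
have t_n n : (n <= t n)%N.
  elim: n => [//|n IH]; apply: leq_trans (t_step n).
  have [_ d0 /andP[dm mc] _ _] := FP n; lia.
have delta_n n : (n <= delta n)%N by apply: leq_trans (t_n n) _; case: (FP n).
have b_m n : (4 * delta n < m n)%N by case: (FP n) => _ _ /andP[].
have m_c n : (m n <= c n)%N by case: (FP n) => _ _ /andP[].
have t_delta n : (t n <= delta n)%N by case: (FP n).
have delta_c n : (delta n <= c n)%N by have := b_m n; have := m_c n; lia.
have count n : (#|` wball S (4 * c n)| <= N * #|` wball S (delta n)|)%N by case: (FP n).
pose Q := centers delta c; pose beta n := (3 * delta n)%N; pose b n := (4 * delta n)%N.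
have beta_b n : (beta n + t n <= b n)%N by rewrite /beta /b; have := t_delta n; lia.
have Qsep n p q : Q n p -> Q n q -> gball G (2 * c n + t n) [set p] q -> p = q.
  move=> Qp Qq /(gball_schreier S _ _ _ borel_a.1)[g ng E]; subst q.
  (* [2 * c n + t n] is at most [3 * c n], the separation of the markers, since
     [t n <= delta n <= c n]. *)
  rewrite (centers_sep Qp Qq) ?a1 //; apply: gball_le ng.
  by have := t_delta n; have := delta_c n; lia.
have Qann n p : Q n p -> annular G b m c n p.
  by move=> _; apply: annular_act; case: (FP n).
have Qsph n p : Q n p -> sphere G (m n) p !=set0 by move=> _; apply: sphere_nonempty.
have Qb n : borel (Q n) by apply: centers_borel.
have hc n p : hull G Q beta m c n p p.
  exact: (hull_center Gsym t_step beta_b b_m Qsep).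
pose T := [set K : {fset X} | exists n p, Q n p /\ [set` K] = hull G Q beta m c n p].
have hullT n p : Q n p -> exists2 K : {fset X}, T K & [set` K] = hull G Q beta m c n p.
  move=> Qp; have fin : finite_set (hull G Q beta m c n p) by apply: hull_finite.
  exists (fset_set (hull G Q beta m c n p)); last by rewrite fset_setK.
  by exists n, p; rewrite fset_setK.
have fset_eq (K L : {fset X}) : [set` K] = [set` L] -> K = L.
  by move=> KL; rewrite -(set_fsetK K) KL set_fsetK.
exists T; split; first split.
- exact: (hulls_borel finS genS borel_a free_a Qb (fun n p _ => hc n p) sepU).
- apply/seteqP; split=> [[x y] [K _ [xy _ _]]|[x y] [/= xy _ _]]; first by split.
  have [n [p [Qp px py]]] := centers_cover delta_n delta_c count xy.
  have [K TK KE] := hullT n p Qp.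
  have inK z : gball G (3 * delta n) [set p] z -> [set` K] z.
    by rewrite KE; apply: (hull_beta Gsym t_step beta_b b_m Qsep).
  by exists K => //; split=> //; apply: inK.
- move=> K L [n [p [Qp KE]]] [n' [p' [Qp' LE]]] KL; rewrite KE LE.
  apply: (hull_toast Gsym t_step beta_b b_m m_c Qsep Qp Qp') => E.
  by apply: KL; apply: fset_eq; rewrite KE LE.
move=> K [n [p [Qp KE]]]; rewrite KE.
have := hull_minus_connected Gsym t_step beta_b b_m m_c Qsep Qann Qsph Qp.
congr (connected_in G _); congr (_ `\` _).
apply/seteqP; split=> [x [L [[j [q [Qq LE]]] [LK neq]] Lx]|x [L [[j [q [Qq LE]]] LK] Lx]].
  have [K' TK' K'E] := hullT j q Qq; exists K'; last by rewrite K'E -LE.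
  split=> //; rewrite fproperEneq; apply/andP; split.
    by apply/eqP => KK'; apply: neq; rewrite LE -K'E KK' KE.
  apply/fsubsetP => y yK'; have : [set` K] y by rewrite KE; apply: LK; rewrite LE -K'E.
  by [].
exists [set` L] => //; split; first by exists j, q.
move: LK; rewrite fproperEneq => /andP[/eqP neq /fsubsetP LK]; rewrite -KE; split.
  by move=> y /LK.
by move=> /fset_eq.
Qed.

End ToastConstruction.

Theorem theorem3p16 (R : realType) (X : topologicalType) (hX : polish R X)
    (Gamma : groupType) (S : set Gamma) (finS : finite_set S)
    (genS : generates S) (growth : polynomial_growth S)
    (ends : one_ended (cayley_graph S))
    (a : Gamma -> X -> X) (borel_a : borel_action a) (free_a : free_action a) :
  exists T : set {fset X}, connected_toast (schreier_graph S a) T.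
Proof.
have [U sepU] := polish_separating hX.
exact: (connected_toast_exists sepU finS genS ends borel_a free_a growth).
Qed.
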